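(* Let $k$ be a field of characteristic zero, let $X$ be a finite set with $n=|X|$, let $\mathcal{R}_X$ be the $k$-algebra of the monoid of all relations on $X$, and let $J(\mathcal{R}_X)$ be its Jacobson radical. Then $$\dim J(\mathcal{R}_X)=2^{n^2}-\sum_{e=0}^n\sum_R\frac{1}{|\mathrm{Aut}(E,R)|}\Big(\sum_{i=0}^e(-1)^i\binom{e}{i}(|G_{E,R}|-i)^n\Big)^2,$$ where, for each $e$, $R$ runs over a set of representatives of the $\Sigma_e$-conjugacy classes of order relations on the set $E=\{1,\dots,e\}$ (with $E=\emptyset$ if $e=0$).
   Context: A relation on $X$ is a subset of $X\times X$; relations form a monoid under $SQ=\{(z,x)\mid\exists y\in X,\ (z,y)\in S,\ (y,x)\in Q\}$, and $\mathcal{R}_X$ is the monoid algebra over $k$ (of dimension $2^{n^2}$). An order relation means a partial order; $\Sigma_e$ is the symmetric group on $\{1,\dots,e\}$, so representatives of conjugacy classes of orders are representatives of isomorphism classes of posets of size $e$. $\mathrm{Aut}(E,R)$ is the group of automorphisms of the poset $(E,R)$. Definition of $|G_{E,R}|$: choose any finite lattice $T$ whose full subposet of join-irreducible elements $\mathrm{Irr}(T)$ is $(E,R)$ (for instance the lattice of lower ideals of $(E,R)$, with $e\in E$ identified with the principal ideal it generates); the cardinality below does not depend on the choice of $T$. Here $e\in T$ is irreducible if $e=\bigvee_{a\in A}a$ with $A\subseteq T$ implies $e\in A$ (so $\hat0$ is not irreducible). For $t\in T$, $r(t)$ is the join of all elements strictly smaller than $t$, and $r^\infty(t)$ is the stable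 value of the iterates $r^m(t)$; $\sigma(t)$ is the meet of all irreducible elements strictly larger than $t$ (empty meet $=\hat1$), and $\sigma^\infty(t)$ is the stable value of the iterates $\sigma^m(t)$. $\Lambda E$ is the set of all meets of (possibly empty) families of elements of $E$; $\widehat G$ is the set of $t\in T$ with $t\notin\Lambda E$ such that there is $e\in E$ with $t=r^\infty(e)$ and $\sigma(e)=e$. Then $G_{E,R}=\Lambda E\sqcup\widehat G$ (equivalently, $E\sqcup\{t\in T\mid t=r^\infty(\sigma^\infty(t))\}$). *)

(* Defs.v *)
From HB Require Import structures.
From mathcomp Require Import all_boot all_order all_algebra all_fingroup all_field.
From mathcomp Require Import ring_quotient.

Set Implicit Arguments.
Unset Strict Implicit.
Unset Printing Implicit Defensive.

Import Order.Theory GRing.Theory.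

(* A copy of {set X * X} carrying the composition of relations as monoid law;
   {set X * X} itself is left free for the elementwise product of subsets. *)
Definition relation (X : finType) : Type := {set X * X}.

HB.instance Definition _ (X : finType) := Finite.copy (relation X) {set X * X}.

Section RelationMonoid.
Variable X : finType.

Definition rel_comp (S Q : relation X) : relation X :=
  [set p : X * X | [exists y, ((p.1, y) \in S) && ((y, p.2) \in Q)]].

Definition rel_id : relation X := [set p : X * X | p.1 == p.2].

Lemma rel_compP (S Q : relation X) z x :
  reflect (exists y, (z, y) \in S /\ (y, x) \in Q) ((z, x) \in rel_comp S Q).
Proof.
by rewrite inE; apply: (iffP existsP) => -[y] => [/andP[]|[? ?]]; exists y;
  last exact/andP.
Qed.

Lemma rel_compA : associative rel_comp.
Proof.
move=> S Q P; apply/setP => -[z x].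
apply/rel_compP/rel_compP => [[y [zy /rel_compP[w [yw wx]]]]|].
  by exists w; split=> //; apply/rel_compP; exists y.
case=> w [/rel_compP[y [zy yw]] wx].
by exists y; split=> //; apply/rel_compP; exists w.
Qed.

Lemma rel_comp1l : left_id rel_id rel_comp.
Proof.
move=> S; apply/setP => -[z x]; apply/rel_compP/idP.
  by case=> y [+ yx]; rewrite inE /= => /eqP->.
by move=> zx; exists z; rewrite inE eqxx.
Qed.

Lemma rel_comp1r : right_id rel_id rel_comp.
Proof.
move=> S; apply/setP => -[z x]; apply/rel_compP/idP.
  by case=> y [zy]; rewrite inE /= => /eqP<-.
by move=> zx; exists x; rewrite inE eqxx.
Qed.

HB.instance Definition _ :=
  isMonoid.Build (relation X) rel_compA rel_comp1l rel_comp1r.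

End RelationMonoid.

(* The monoid algebra of [relation X]: f stands for \sum_S f(S) S. *)
Definition rel_alg (k : fieldType) (X : finType) : Type :=
  {ffun relation X -> k^o}.

HB.instance Definition _ (k : fieldType) (X : finType) :=
  Vector.copy (rel_alg k X) {ffun relation X -> k^o}.

Section RelationAlgebra.
Variables (k : fieldType) (X : finType).
Local Open Scope ring_scope.
Implicit Types (f g h : rel_alg k X) (S Q U : relation X).

Definition rel_alg_one : rel_alg k X :=
  [ffun S : relation X => (S == 1%g)%:R : k^o].

Definition rel_alg_mul f g : rel_alg k X :=
  [ffun U : relation X =>
     (\sum_(p : relation X * relation X | (p.1 * p.2)%g == U)
         f p.1 * g p.2) : k^o].

Lemma rel_alg_mulE f g U :
  rel_alg_mul f g U = \sum_S \sum_Q f S * g Q * ((S * Q)%g == U)%:R.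
Proof.
rewrite ffunE pair_bigA /= big_mkcond; apply: eq_bigr => p _.
by case: eqP; rewrite ?mulr1 ?mulr0.
Qed.

Lemma rel_alg_mul_sum f g (F : relation X -> k) :
  \sum_U rel_alg_mul f g U * F U = \sum_S \sum_Q f S * g Q * F (S * Q)%g.
Proof.
rewrite pair_bigA /=.
rewrite (partition_big
  (fun p : relation X * relation X => (p.1 * p.2)%g) predT) //=.
apply: eq_bigr => U _; rewrite ffunE mulr_suml.
by apply: eq_bigr => p /eqP->.
Qed.

Lemma rel_alg_mulA : associative rel_alg_mul.
Proof.
move=> f g h; apply/ffunP => W; rewrite !rel_alg_mulE.
pose F (V : relation X) : k := \sum_U h U * ((V * U)%g == W)%:R.
transitivity (\sum_S \sum_Q f S * g Q * F (S * Q)%g); last first.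
  rewrite -rel_alg_mul_sum; apply: eq_bigr => V _.
  by rewrite mulr_sumr; apply: eq_bigr => U _; rewrite mulrA.
apply: eq_bigr => S _.
pose G (V : relation X) : k := f S * ((S * V)%g == W)%:R.
transitivity (\sum_V rel_alg_mul g h V * G V).
  by apply: eq_bigr => V _; rewrite /G mulrCA mulrA.
rewrite rel_alg_mul_sum; apply: eq_bigr => Q _.
rewrite mulr_sumr; apply: eq_bigr => U _.
by rewrite /G mulgA !mulrA; congr (_ * _); rewrite mulrC mulrA.
Qed.

Lemma rel_alg_mul1l : left_id rel_alg_one rel_alg_mul.
Proof.
move=> f; apply/ffunP => U; rewrite rel_alg_mulE (bigD1 (1%g : relation X)) //=.
rewrite [X in _ + X]big1 => [|S /negbTE S1]; last first.
  by rewrite big1 // => Q _; rewrite ffunE S1 !mul0r.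
rewrite addr0 (bigD1 U) //= big1 => [|Q /negbTE QU]; last first.
  by rewrite mul1g QU mulr0.
by rewrite ffunE mul1g !eqxx mul1r mulr1 addr0.
Qed.

Lemma rel_alg_mul1r : right_id rel_alg_one rel_alg_mul.
Proof.
move=> f; apply/ffunP => U; rewrite rel_alg_mulE exchange_big (bigD1 (1%g : relation X)) //=.
rewrite [X in _ + X]big1 => [|S /negbTE S1]; last first.
  by rewrite big1 // => Q _; rewrite ffunE S1 mulr0 mul0r.
rewrite addr0 (bigD1 U) //= big1 => [|Q /negbTE QU]; last first.
  by rewrite mulg1 QU mulr0.
by rewrite ffunE mulg1 !eqxx !mulr1 addr0.
Qed.

Lemma rel_alg_mulDl : left_distributive rel_alg_mul +%R.
Proof.
move=> f g h; apply/ffunP => U; rewrite !ffunE -big_split /=.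
by apply: eq_bigr => p _; rewrite ffunE mulrDl.
Qed.

Lemma rel_alg_mulDr : right_distributive rel_alg_mul +%R.
Proof.
move=> f g h; apply/ffunP => U; rewrite !ffunE -big_split /=.
by apply: eq_bigr => p _; rewrite ffunE mulrDr.
Qed.

Lemma rel_alg_one_neq0 : rel_alg_one != 0.
Proof.
apply/eqP => /ffunP/(_ 1%g)/eqP.
by rewrite !ffunE eqxx oner_eq0.
Qed.

HB.instance Definition _ := GRing.Zmodule_isNzRing.Build (rel_alg k X)
  rel_alg_mulA rel_alg_mul1l rel_alg_mul1r rel_alg_mulDl rel_alg_mulDr
  rel_alg_one_neq0.

Lemma rel_alg_scaleAl (a : k) f g : a *: (f * g) = (a *: f) * g.
Proof.
apply/ffunP => U; rewrite !ffunE scaler_sumr; apply: eq_bigr => p _.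
by rewrite ffunE; exact: mulrA.
Qed.

HB.instance Definition _ :=
  GRing.Lmodule_isLalgebra.Build k (rel_alg k X) rel_alg_scaleAl.

Lemma rel_alg_scaleAr (a : k) f g : a *: (f * g) = f * (a *: g).
Proof.
apply/ffunP => U; rewrite !ffunE scaler_sumr; apply: eq_bigr => p _.
by rewrite ffunE; exact: mulrCA.
Qed.

HB.instance Definition _ :=
  GRing.Lalgebra_isAlgebra.Build k (rel_alg k X) rel_alg_scaleAr.

HB.instance Definition _ := Algebra_isFalgebra.Build k (rel_alg k X).

End RelationAlgebra.

(* [idealr_closed I] says that I is a proper left ideal: it contains 0, not 1,
   and a * u + v for all u, v in I and all a in A. *)
Definition maximal_left_ideal (A : nzRingType) (I : {pred A}) : Prop :=
  idealr_closed I /\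
  forall I' : {pred A},
    idealr_closed I' -> {subset I <= I'} -> {subset I' <= I}.

Definition in_jacobson (A : nzRingType) (a : A) : Prop :=
  forall I : {pred A}, maximal_left_ideal I -> a \in I.

Section FiniteLattice.
Variables (d : Order.disp_t) (T : finTBLatticeType d).
Local Open Scope order_scope.
Implicit Types (t e : T) (A : {set T}).

Definition irreducible e : bool :=
  [forall A : {set T}, (e == \join_(a in A) a) ==> (e \in A)].

Definition Irr : {set T} := [set e | irreducible e].

Definition rdown t : T := \join_(s : T | s < t) s.

(* rdown t <= t, so the iterates are stationary from rank #|T| on
   (rdown_infP below). *)
Definition rdown_inf t : T := iter #|T| rdown t.

Definition sigma t : T := \meet_(e in Irr | t < e) e.

Definition Lambda_Irr : {set T} :=
  [set \meet_(a in A) a | A : {set T} in powerset Irr].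

Definition G_hat : {set T} :=
  [set t | (t \notin Lambda_Irr) &&
     [exists e in Irr, (t == rdown_inf e) && (sigma e == e)]].

Definition G_set : {set T} := Lambda_Irr :|: G_hat.

Lemma rdown_le t : rdown t <= t.
Proof. by apply/joinsP => s /ltW. Qed.

Lemma rdown_infP t : rdown (rdown_inf t) = rdown_inf t.
Proof.
pose below m := [set s : T | s <= iter m rdown t].
have card_lt m : rdown (iter m rdown t) != iter m rdown t ->
    (#|below m| + m <= #|T|)%N.
  elim: m => [|m IHm] neq; first by rewrite addn0 max_card.
  have neq' : rdown (iter m rdown t) != iter m rdown t.
    by apply: contraNneq neq => eqm; rewrite iterS !eqm.
  apply: leq_trans (IHm neq'); rewrite addnS -addSn leq_add2r.
  apply/proper_card/properP; split.
    apply/subsetP => s; rewrite !inE => /le_trans; apply; exact: rdown_le.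
  exists (iter m rdown t); rewrite !inE ?lexx //.
  by apply: contra neq' => le; rewrite eq_le rdown_le.
apply/eqP/negPn/negP => /card_lt.
rewrite leqNgt -[X in (X < _)%N]add0n ltn_add2r.
by rewrite (cardD1 (rdown_inf t)) inE lexx.
Qed.

End FiniteLattice.

Section Orders.
Variable T : finType.
Implicit Types (R : {set T * T}) (s : {perm T}).

Definition is_order R : bool :=
  [&& [forall x, (x, x) \in R],
      [forall x, forall y, ((x, y) \in R) && ((y, x) \in R) ==> (x == y)]
    & [forall x, forall y, forall z,
        ((x, y) \in R) && ((y, z) \in R) ==> ((x, z) \in R)]].

Definition orders : {set {set T * T}} := [set R | is_order R].

Definition perm_pair (p : T * T) s : T * T := (s p.1, s p.2).

Lemma perm_pair1 : perm_pair^~ 1%g =1 id.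
Proof. by case=> x y; rewrite /perm_pair !perm1. Qed.

Lemma perm_pairM p : act_morph perm_pair p.
Proof. by move=> s1 s2; rewrite /perm_pair !permM. Qed.

Canonical pair_action := TotalAction perm_pair1 perm_pairM.

Definition order_classes : {set {set {set T * T}}} :=
  (orbit (pair_action^*)%act [set: {perm T}] @: orders)%g.

Definition order_representatives (Rs : {set {set T * T}}) : bool :=
  is_transversal Rs order_classes orders.

Definition poset_aut R : {set {perm T}} :=
  [set s : {perm T} |
     [forall x, forall y, ((s x, s y) \in R) == ((x, y) \in R)]].

(* (x, y) \in R is read x <=_R y. *)
Definition irr_poset_is d (L : finTBLatticeType d) R : Prop :=
  exists f : T -> L,
    [/\ injective f, f @: setT = Irr L
      & forall x y, ((x, y) \in R) = (f x <= f y)%O].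

End Orders.

(* Main.v *)
Require Import Defs.
From HB Require Import structures.
From mathcomp Require Import all_boot all_order all_algebra all_fingroup all_field.
From Stdlib Require Import Classical ClassicalEpsilon.

Set Implicit Arguments.
Unset Strict Implicit.
Unset Printing Implicit Defensive.

Import GRing.Theory.
Local Open Scope ring_scope.

(* For an order R on E = {1, ..., e} and relations V between E and X, U between X
   and E, consider the linear form a |-> sum_P a(P) [id <= V P U <= R^op] on the
   relation algebra.  The Jacobson radical is the common kernel J of these forms
   over all orders R with e <= |X|.
   - J lies in the radical.  Filter the relations by the least e through which they
     factor as Q V, then by the size of the right ideal generated by Q.  If Q does
     not factor through a smaller set, its columns are distinct, hence ordered by
     inclusion, and Q P stays in the layer of Q only if Q P = Q s for a permutation
     s; the coefficient of such a term in Q (V a U) is one of the forms.  So every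
     a in J is nilpotent.
   - The radical lies in J.  The forms with V and U moved by Aut(E, R) make up a
     matrix Y(a) with Y(a) Y(b) = Y(a z b) for a fixed relation z.  If a is in the
     radical, then z a, hence Y(a), is nilpotent; but the trace of Y(a) is
     |Aut(E, R)| times a form, and the characteristic is 0.
   - If the matrix [id <= V U <= R^op] has a column basis of m elements, permuted
     freely by Aut(E, R), then the forms attached to R span a space of dimension
     m^2 / |Aut(E, R)|, and non-conjugate orders contribute independently, by
     triangularity.
   - m is the number of maps phi : X -> G_{E,R} with E contained in phi(X): a column
     depends on U only through the map phi(x) = join of U_x to the lattice T;
     values outside G are eliminated step by step along chains t < sigma t < ...;
     the remaining columns have Moebius transforms with distinct leading terms. *)

(** * Relations between different sets *)

Section HeterogeneousRelations.
Implicit Types A B C D : finType.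

Definition rcomp A B C (S : {set A * B}) (Q : {set B * C}) : {set A * C} :=
  [set p | [exists y, ((p.1, y) \in S) && ((y, p.2) \in Q)]].

Definition rtr A B (S : {set A * B}) : {set B * A} := [set p | (p.2, p.1) \in S].

Definition lperm A B (s : {perm A}) (S : {set A * B}) : {set A * B} :=
  [set p | (s p.1, p.2) \in S].

Definition rperm A B (s : {perm B}) (S : {set A * B}) : {set A * B} :=
  [set p | (p.1, s p.2) \in S].

Lemma rcompP A B C (S : {set A * B}) (Q : {set B * C}) a c :
  reflect (exists2 y, (a, y) \in S & (y, c) \in Q) ((a, c) \in rcomp S Q).
Proof.
rewrite inE; apply: (iffP existsP) => -[y] => [/andP[]|? ?]; exists y => //=.
exact/andP.
Qed.

Lemma mem_rtr A B (S : {set A * B}) a b : ((b, a) \in rtr S) = ((a, b) \in S).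
Proof. by rewrite inE. Qed.

Lemma mem_lperm A B (s : {perm A}) (S : {set A * B}) a b :
  ((a, b) \in lperm s S) = ((s a, b) \in S).
Proof. by rewrite inE. Qed.

Lemma mem_rperm A B (s : {perm B}) (S : {set A * B}) a b :
  ((a, b) \in rperm s S) = ((a, s b) \in S).
Proof. by rewrite inE. Qed.

Lemma rcompA A B C D (S : {set A * B}) (Q : {set B * C}) (P : {set C * D}) :
  rcomp S (rcomp Q P) = rcomp (rcomp S Q) P.
Proof.
apply/setP => -[a d]; apply/rcompP/rcompP => [[b ab /rcompP[c bc cd]]|].
  by exists c => //; apply/rcompP; exists b.
by case=> c /rcompP[b ab bc] cd; exists b => //; apply/rcompP; exists c.
Qed.

Lemma rel_mulE (X : finType) (S Q : relation X) : (S * Q)%g = rcomp S Q.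
Proof. by []. Qed.

Lemma rcomp_rel_id A (X : finType) (S : {set A * X}) :
  rcomp S (1%g : relation X) = S.
Proof.
apply/setP => -[z x]; apply/rcompP/idP => [[y zy]|zx].
  by rewrite inE /= => /eqP <-.
by exists x => //; rewrite inE /=.
Qed.

Lemma rperm_rcomp A B C (s : {perm C}) (S : {set A * B}) (Q : {set B * C}) :
  rperm s (rcomp S Q) = rcomp S (rperm s Q).
Proof.
apply/setP => -[a c]; rewrite mem_rperm.
by apply/rcompP/rcompP => -[y ay yc]; exists y => //; move: yc; rewrite mem_rperm.
Qed.

Lemma lperm_rcomp A B C (s : {perm A}) (S : {set A * B}) (Q : {set B * C}) :
  lperm s (rcomp S Q) = rcomp (lperm s S) Q.
Proof.
apply/setP => -[a c]; rewrite mem_lperm.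
by apply/rcompP/rcompP => -[y ay yc]; exists y => //; move: ay; rewrite mem_lperm.
Qed.

Lemma rpermM A B (s t : {perm B}) (S : {set A * B}) :
  rperm s (rperm t S) = rperm (s * t) S.
Proof. by apply/setP => -[a b]; rewrite !mem_rperm permM. Qed.

Lemma lpermM A B (s t : {perm A}) (S : {set A * B}) :
  lperm s (lperm t S) = lperm (s * t) S.
Proof. by apply/setP => -[a b]; rewrite !mem_lperm permM. Qed.

Lemma rperm1 A B (S : {set A * B}) : rperm 1%g S = S.
Proof. by apply/setP => -[a b]; rewrite mem_rperm perm1. Qed.

Lemma lperm1 A B (S : {set A * B}) : lperm 1%g S = S.
Proof. by apply/setP => -[a b]; rewrite mem_lperm perm1. Qed.

Lemma rperm_inj A B (s : {perm B}) : injective (@rperm A B s).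
Proof. by apply: (can_inj (g := rperm s^-1%g)) => S; rewrite rpermM mulVg rperm1. Qed.

End HeterogeneousRelations.

(** * Relations between the identity and an opposite order *)

Section Between.
Variable E : finType.
Implicit Types (R : {set E * E}) (W : {set E * E}).

Definition between R W : bool :=
  [forall a, (a, a) \in W] && [forall a, forall b, ((a, b) \in W) ==> ((b, a) \in R)].

Lemma betweenP R W :
  reflect ((forall a, (a, a) \in W) /\ (forall a b, (a, b) \in W -> (b, a) \in R))
          (between R W).
Proof.
apply: (iffP andP) => -[H1 H2]; split.
- exact/forallP.
- by move=> a b; move/forallP/(_ a)/forallP/(_ b)/implyP: H2.
- exact/forallP.
- by apply/forallP => a; apply/forallP => b; apply/implyP/H2.
Qed.

Lemma orderP R :
  reflect [/\ forall x, (x, x) \in R,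
              forall x y, (x, y) \in R -> (y, x) \in R -> x = y
            & forall x y z, (x, y) \in R -> (y, z) \in R -> (x, z) \in R]
          (is_order R).
Proof.
apply: (iffP and3P) => -[H1 H2 H3]; split.
- exact/forallP.
- move=> x y xy yx; apply/eqP.
  by move/forallP/(_ x)/forallP/(_ y)/implyP: H2; apply; rewrite xy.
- move=> x y z xy yz.
  by move/forallP/(_ x)/forallP/(_ y)/forallP/(_ z)/implyP: H3; apply; rewrite xy.
- exact/forallP.
- apply/forallP => x; apply/forallP => y; apply/implyP => /andP[xy yx].
  exact/eqP/H2.
- apply/forallP => x; apply/forallP => y; apply/forallP => z.
  by apply/implyP => /andP[]; apply: H3.
Qed.

Lemma poset_autP R (s : {perm E}) :
  reflect (forall x y, ((s x, s y) \in R) = ((x, y) \in R)) (s \in poset_aut R).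
Proof.
rewrite inE; apply: (iffP forallP) => [H x y|H x].
  by have /forallP/(_ y)/eqP := H x.
by apply/forallP => y; rewrite H.
Qed.

Lemma poset_aut_group R : group_set (poset_aut R).
Proof.
apply/group_setP; split; first by apply/poset_autP => x y; rewrite !perm1.
move=> s t /poset_autP Hs /poset_autP Ht; apply/poset_autP => x y.
by rewrite !permM Ht Hs.
Qed.
Canonical poset_aut_groupType R := Group (poset_aut_group R).

Lemma between_conj R R' W (s : {perm E}) :
  (forall x y, ((s x, s y) \in R') = ((x, y) \in R)) ->
  between R (lperm s (rperm s W)) = between R' W.
Proof.
move=> Hs; apply/betweenP/betweenP => -[H1 H2]; split => [a|a b].
- by have := H1 (s^-1%g a); rewrite mem_lperm mem_rperm permKV.
- move=> ab; have := H2 (s^-1%g a) (s^-1%g b).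
  by rewrite mem_lperm mem_rperm -Hs !permKV; apply.
- by rewrite mem_lperm mem_rperm.
- by rewrite mem_lperm mem_rperm => /H2; rewrite Hs.
Qed.

Lemma card_perm_preim R (s : {perm E}) : #|lperm s (rperm s R)| = #|R|.
Proof.
pose g (p : E * E) := (s p.1, s p.2).
have g_inj : injective g by move=> [x y] [x' y'] [] /perm_inj -> /perm_inj ->.
rewrite -(card_imset _ g_inj); congr #|pred_of_set _|; apply/setP => -[x y].
apply/imsetP/idP => [[[x' y']]|xy]; first by rewrite mem_lperm mem_rperm => h ->.
by exists (s^-1%g x, s^-1%g y); rewrite ?mem_lperm ?mem_rperm /g /= !permKV.
Qed.

(** The preimage of [R] under [s] has as many elements as [R], so its inclusion in [R'], which is no
    larger, is an equality. *)
Lemma perm_reflects_order R R' (s : {perm E}) : (#|R'| <= #|R|)%N ->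
  (forall a b, (s a, s b) \in R -> (a, b) \in R') ->
  forall a b, ((s a, s b) \in R) = ((a, b) \in R').
Proof.
move=> leR sR a b; rewrite -mem_rperm -mem_lperm; congr (_ \in pred_of_set _).
apply/eqP; rewrite eqEcard card_perm_preim leR andbT.
by apply/subsetP => -[x y]; rewrite mem_lperm mem_rperm; apply: sR.
Qed.

End Between.

(** The diagonal of the composite passes, for each [a], through a point [s a] of [E]. If
    [s a = s b], the composite contains [(a, b)] and [(b, a)], and antisymmetry of [R'] gives
    [a = b]. *)
Lemma between_factor (E E' : finType) (R : {set E * E}) (R' : {set E' * E'})
    (W : {set E' * E}) (W' : {set E * E'}) :
  is_order R -> is_order R' -> between R' (rcomp W (rcomp (rtr R) W')) ->
  exists s : E' -> E,
    [/\ injective s, forall a b, (s b, s a) \in R -> (b, a) \in R',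
        forall a, (a, s a) \in rcomp W (rtr R) & forall a, (s a, a) \in W'].
Proof.
move=> /orderP[Rr Ra Rt] /orderP[R'r R'a R't]; rewrite rcompA.
case/betweenP => H1 H2.
have ex a : exists b, ((a, b) \in rcomp W (rtr R)) && ((b, a) \in W').
  by have /rcompP[b h1 h2] := H1 a; exists b; rewrite h1.
have [s Hs] := fin_all_exists ex.
have Hs1 a : (a, s a) \in rcomp W (rtr R) by case/andP: (Hs a).
have Hs2 a : (s a, a) \in W' by case/andP: (Hs a).
exists s; split=> //.
  move=> a b eq_s; apply: R'a; apply: H2; apply/rcompP.
    by exists (s b) => //; rewrite -eq_s.
  by exists (s a) => //; rewrite eq_s.
move=> a b ba; apply: H2; apply/rcompP; exists (s b) => //.
have /rcompP[c ac] := Hs1 a; rewrite mem_rtr => ca; apply/rcompP.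
by exists c => //; rewrite mem_rtr; apply: Rt ca.
Qed.

(** Separating the two factors is what makes the forms multiplicative. If the composite satisfies
    [between], the map from [between_factor] is an automorphism and gives the only nonzero term. *)
Lemma between_decompose (k : fieldType) (E : finType) (R W W' : {set E * E}) :
  is_order R ->
  (between R (rcomp W (rcomp (rtr R) W')))%:R =
  \sum_(s in poset_aut R)
     (between R (rperm s W))%:R * (between R (lperm s W'))%:R :> k.
Proof.
move=> ordR; have /orderP[Rr Ra Rt] := ordR.
have uniq s t : s \in poset_aut R -> t \in poset_aut R ->
    between R (rperm s W) -> between R (rperm t W) -> s = t.
  move=> /poset_autP As /poset_autP At /betweenP[s1 s2] /betweenP[t1 t2].
  apply/permP => a; apply: Ra.
    have := t2 a (t^-1%g (s a)); rewrite mem_rperm permKV -At permKV; apply.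
    by have := s1 a; rewrite mem_rperm.
  have := s2 a (s^-1%g (t a)); rewrite mem_rperm permKV -As permKV; apply.
  by have := t1 a; rewrite mem_rperm.
case: (boolP (between R _)) => [Hb|nHb].
  have [s [s_inj s_refl Hs1 Hs2]] := between_factor ordR ordR Hb.
  pose p := perm s_inj.
  have pA : p \in poset_aut R.
    by apply/poset_autP/perm_reflects_order => // a b; rewrite !permE; apply: s_refl.
  have := pA => /poset_autP Hp.
  have /betweenP[H1 H2] := Hb.
  (* So far [(a, p a)] lies only in [W R^op]; the intermediate point [d] equals [p a] by
     antisymmetry. *)
  have Wp a : (a, p a) \in W.
    have /rcompP[d ad] := Hs1 a; rewrite mem_rtr -(permE s_inj) -/p => pad.
    suff -> : p a = d by [].
    apply: Ra => //; pose c := p^-1%g d.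
    have dE : d = p c by rewrite permKV.
    rewrite dE Hp; apply: H2; apply/rcompP; exists d => //; apply/rcompP.
    by exists d; rewrite ?mem_rtr // dE permE.
  have bW : between R (rperm p W).
    apply/betweenP; split=> [a|a b]; first by rewrite mem_rperm.
    rewrite mem_rperm => apb; apply: H2; apply/rcompP; exists (p b) => //.
    by apply/rcompP; exists (p b); rewrite ?mem_rtr // permE.
  have bW' : between R (lperm p W').
    apply/betweenP; split=> [a|a b]; first by rewrite mem_lperm permE.
    rewrite mem_lperm => pab; apply: H2; apply/rcompP; exists (p a) => //.
    by apply/rcompP; exists (p a); rewrite ?mem_rtr.
  rewrite (bigD1 p) //= bW bW' mulr1 big1 ?addr0 // => t /andP[tA /negbTE tp].
  case: (boolP (between R (rperm t W))) => bt; last by rewrite mul0r.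
  by have := uniq _ _ tA pA bt bW => eqt; rewrite eqt eqxx in tp.
rewrite big1 // => s /poset_autP Hs.
case: (boolP (between R (rperm s W))) => [/betweenP[H1 H2]|_]; last by rewrite mul0r.
case: (boolP (between R (lperm s W'))) => [/betweenP[H3 H4]|_]; last by rewrite mulr0.
case/negP: nHb; apply/betweenP; split=> [a|a b].
  apply/rcompP; exists (s a); first by have := H1 a; rewrite mem_rperm.
  by apply/rcompP; exists (s a); rewrite ?mem_rtr //; have := H3 a; rewrite mem_lperm.
case/rcompP => c ac /rcompP[d]; rewrite mem_rtr => dc db.
apply: (Rt _ (s^-1%g d)).
  by apply: H4; rewrite mem_lperm permKV.
apply: (Rt _ (s^-1%g c)).
  by rewrite -Hs !permKV.
by apply: H2; rewrite mem_rperm permKV.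
Qed.

(** * Relations not factoring through a smaller set *)

Section Essential.
Implicit Types A B C : finType.

Definition factors_through A B (e : nat) (S : {set A * B}) : Prop :=
  exists Q : {set A * 'I_e}, exists V : {set 'I_e * B}, S = rcomp Q V.

Definition factors_below A B (e : nat) (S : {set A * B}) : Prop :=
  exists2 e', (e' < e)%N & factors_through e' S.

Lemma factors_below_rcompl A B C (e : nat) (S : {set A * B}) (Q : {set B * C}) :
  factors_below e S -> factors_below e (rcomp S Q).
Proof.
case=> e' lt [P [V ->]]; exists e' => //; exists P, (rcomp V Q).
by rewrite rcompA.
Qed.

Lemma factors_below_rcompr A B C (e : nat) (S : {set A * B}) (Q : {set B * C}) :
  factors_below e Q -> factors_below e (rcomp S Q).
Proof.
case=> e' lt [P [V ->]]; exists e' => //; exists (rcomp S P), V.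
by rewrite rcompA.
Qed.

(** The point [a] can be deleted: the right factor rebuilds its column from those of [D]. *)
Lemma factors_below_column A (e : nat) (Q : {set A * 'I_e}) (a : 'I_e) (D : {set 'I_e}) :
  a \notin D ->
  (forall z, ((z, a) \in Q) = [exists c in D, (z, c) \in Q]) ->
  factors_below e Q.
Proof.
case: e Q a D => [|e] Q a D; first by case: a.
move=> aD Qa; exists e => //.
exists [set p : A * 'I_e | (p.1, lift a p.2) \in Q].
exists [set p : 'I_e * 'I_e.+1 |
         (lift a p.1 == p.2) || (p.2 == a) && (lift a p.1 \in D)].
apply/setP => -[z b]; apply/idP/rcompP => [zb|[c]].
  case: (unliftP a b) zb => [c ->|->] zb.
    by exists c; rewrite inE //= eqxx.
  move: zb; rewrite Qa => /existsP[c /andP[cD zc]].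
  case: (unliftP a c) cD zc => [c' ->|->] cD zc; last by rewrite cD in aD.
  by exists c'; rewrite inE //= eqxx cD orbT.
rewrite !inE /= => zc /orP[/eqP <- //|/andP[/eqP-> cD]].
by rewrite Qa; apply/existsP; exists (lift a c); rewrite cD.
Qed.

(* The order of reverse inclusion between the columns of Q, so that
   [between (column_order Q) W] bounds W by column inclusion. *)
Definition column_order A (E : finType) (Q : {set A * E}) : {set E * E} :=
  [set p | [forall z, ((z, p.2) \in Q) ==> ((z, p.1) \in Q)]].

Lemma column_orderP A (E : finType) (Q : {set A * E}) a b :
  reflect (forall z, (z, b) \in Q -> (z, a) \in Q) ((a, b) \in column_order Q).
Proof.
rewrite inE; apply: (iffP forallP) => H z; first by move/implyP: (H z).
exact/implyP/H.
Qed.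

Variables (A : finType) (e : nat).
Implicit Types (Q : {set A * 'I_e}) (P : {set 'I_e * 'I_e}).

Lemma column_order_is_order Q : ~ factors_below e Q -> is_order (column_order Q).
Proof.
move=> nlow; apply/orderP; split.
- by move=> x; apply/column_orderP.
- move=> x y /column_orderP xy /column_orderP yx; apply/eqP/negPn/negP => nxy.
  apply: nlow; apply: (@factors_below_column _ _ _ x [set y]); rewrite ?inE // => z.
  apply/idP/existsP => [/yx zy|[c]]; first by exists y; rewrite inE eqxx.
  by rewrite inE => /andP[/eqP-> /xy].
- move=> x y z /column_orderP xy /column_orderP yz; apply/column_orderP => t /yz.
  exact: xy.
Qed.

(** If [P] missed [(a, a)], then [Q = Q P] would make column [a] of [Q] a union of other columns,
    and [Q] would factor through a smaller set. *)
Lemma rcomp_stableP Q P : ~ factors_below e Q ->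
  rcomp Q P = Q <-> between (column_order Q) P.
Proof.
move=> nlow; split=> [QP|/betweenP[H1 H2]]; last first.
  apply/setP => -[z b]; apply/rcompP/idP => [[a za /H2/column_orderP]|zb].
    exact.
  by exists b.
have H2 a b : (a, b) \in P -> (b, a) \in column_order Q.
  by move=> ab; apply/column_orderP => z za; rewrite -QP; apply/rcompP; exists a.
apply/betweenP; split=> // a; apply/negPn/negP => naa; apply: nlow.
apply: (@factors_below_column _ _ _ a [set c | (c, a) \in P]); rewrite ?inE // => z.
rewrite -{1}QP; apply/rcompP/existsP => -[c].
  by move=> zc ca; exists c; rewrite inE ca.
by rewrite inE => /andP[ca zc]; exists c.
Qed.

(** [P P'] fixes [Q], hence contains the identity; the intermediate points on its diagonal form the
    permutation, injective by antisymmetry of [column_order Q]. *)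
Lemma rcomp_retract_perm Q P P' : ~ factors_below e Q ->
  rcomp (rcomp Q P) P' = Q ->
  exists s : {perm 'I_e}, rperm s (rcomp Q P) = Q.
Proof.
move=> nlow; rewrite -rcompA => /(rcomp_stableP _ nlow)/betweenP[H1 H2].
have /orderP[_ anti _] := column_order_is_order nlow.
have ex a : exists b, ((a, b) \in P) && ((b, a) \in P').
  by have /rcompP[b h1 h2] := H1 a; exists b; rewrite h1.
have [s Hs] := fin_all_exists ex.
have Hs1 a : (a, s a) \in P by case/andP: (Hs a).
have Hs2 a : (s a, a) \in P' by case/andP: (Hs a).
have s_inj : injective s.
  move=> a b eq_s; apply: anti; apply: H2; apply/rcompP.
    by exists (s b) => //; rewrite -eq_s.
  by exists (s a) => //; rewrite eq_s.
exists (perm s_inj); rewrite rperm_rcomp; apply/(rcomp_stableP _ nlow)/betweenP.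
split=> [a|a b]; rewrite mem_rperm permE // => ab.
by apply: H2; apply/rcompP; exists (s b).
Qed.

Definition right_orbit Q : {set {set A * 'I_e}} := [set rcomp Q P | P : {set 'I_e * 'I_e}].

Lemma right_orbit_gt0 Q : (0 < #|right_orbit Q|)%N.
Proof. by apply/card_gt0P; exists (rcomp Q set0); apply/imsetP; exists set0. Qed.

(** The right ideal of [Q P] lies in that of [Q]; by cardinality they coincide, so [Q P] can be
    multiplied back to [Q]. *)
Lemma right_orbit_perm Q P : ~ factors_below e Q ->
  (#|right_orbit Q| <= #|right_orbit (rcomp Q P)|)%N ->
  exists s : {perm 'I_e}, rperm s (rcomp Q P) = Q.
Proof.
move=> nlow le.
have sub : right_orbit (rcomp Q P) \subset right_orbit Q.
  apply/subsetP => _ /imsetP[P' _ ->]; apply/imsetP; exists (rcomp P P') => //.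
  by rewrite rcompA.
have /eqP eqo : right_orbit (rcomp Q P) == right_orbit Q by rewrite eqEcard sub le.
have : Q \in right_orbit Q.
  apply/imsetP; exists (1%g : relation 'I_e) => //; by rewrite rcomp_rel_id.
rewrite -eqo => /imsetP[P' _ QE]; exact: (rcomp_retract_perm nlow (esym QE)).
Qed.

End Essential.

(** * The coefficient forms and the filtration by factorization *)

Section MatrixCoefficients.
Variables (k : fieldType) (X : finType).
Local Notation A := (rel_alg k X).
Implicit Types (a b : A) (S P : relation X).

(** The linear extension of [F] from relations to the algebra, evaluated at [a]. *)
Definition pair_alg a (F : relation X -> k) : k := \sum_P a P * F P.

Definition coef a (E : finType) (R : {set E * E}) (V : {set E * X}) (U : {set X * E}) : k :=
  pair_alg a (fun P => (between R (rcomp V (rcomp P U)))%:R).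

Lemma eq_pair_alg a F G : F =1 G -> pair_alg a F = pair_alg a G.
Proof. by move=> FG; apply: eq_bigr => P _; rewrite FG. Qed.

Lemma pair_algM a b F :
  pair_alg (a * b) F = pair_alg a (fun S => pair_alg b (fun Q => F (S * Q)%g)).
Proof.
rewrite /pair_alg rel_alg_mul_sum; apply: eq_bigr => S _.
by rewrite mulr_sumr; apply: eq_bigr => Q _; rewrite mulrA.
Qed.

Lemma pair_alg_sum a (I : finType) (F : I -> relation X -> k) :
  pair_alg a (fun P => \sum_i F i P) = \sum_i pair_alg a (F i).
Proof.
rewrite /pair_alg exchange_big; apply: eq_bigr => P _; exact: mulr_sumr.
Qed.

Lemma pair_algZ a c F : pair_alg a (fun P => c * F P) = c * pair_alg a F.
Proof. by rewrite /pair_alg mulr_sumr; apply: eq_bigr => P _; rewrite mulrCA. Qed.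

Lemma pair_alg_comm a b (F : relation X -> relation X -> k) :
  pair_alg a (fun S => pair_alg b (F S)) = pair_alg b (fun Q => pair_alg a (F^~ Q)).
Proof.
rewrite /pair_alg.
under eq_bigr => S _ do rewrite mulr_sumr.
under [RHS]eq_bigr => Q _ do rewrite mulr_sumr.
rewrite exchange_big; apply: eq_bigr => Q _; apply: eq_bigr => S _; exact: mulrCA.
Qed.

Lemma pair_alg_delta a S : pair_alg a (fun P => (P == S)%:R) = a S.
Proof.
rewrite /pair_alg (bigD1 S) //= eqxx mulr1 big1 ?addr0 // => P /negbTE->.
by rewrite mulr0.
Qed.

Definition annihilates_coefs a : Prop :=
  forall e, (e <= #|X|)%N -> forall R : {set 'I_e * 'I_e}, is_order R ->
  forall V U, coef a R V U = 0.

Lemma annihilates_coefs_mull a b : annihilates_coefs a -> annihilates_coefs (b * a).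
Proof.
move=> Ha e le_e R ordR V U; rewrite /coef pair_algM /pair_alg big1 // => S _.
rewrite -[X in _ * X](_ : 0 = _) ?mulr0 // -[LHS](Ha e le_e R ordR (rcomp V S) U).
by apply: eq_pair_alg => P; rewrite rel_mulE !rcompA.
Qed.

Section Filtration.
Variable e : nat.
Hypothesis le_e : (e <= #|X|)%N.
Variable a : A.
Hypothesis Ha : annihilates_coefs a.

(** If some [P] satisfies [Q V P U = Y], then [Y] is [Q] with permuted columns. After permuting [U],
    the equation becomes the [between] condition for [column_order Q], so the sum is one of the
    forms. *)
Lemma essential_annihilation (Q : {set X * 'I_e}) V (U : {set X * 'I_e}) Y :
  ~ factors_below e Q -> (#|right_orbit Q| <= #|right_orbit Y|)%N ->
  pair_alg a (fun P => (rcomp Q (rcomp V (rcomp P U)) == Y)%:R) = 0.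
Proof.
move=> nlow le.
case: (pickP (fun P : relation X => rcomp Q (rcomp V (rcomp P U)) == Y)) => [P0 /eqP E0|none].
  rewrite -E0 in le; have [s Hs] := right_orbit_perm nlow le.
  rewrite E0 in Hs.
  rewrite -[RHS](Ha le_e (column_order_is_order nlow) V (rperm s U)).
  apply: eq_pair_alg => P; congr (nat_of_bool _)%:R.
  rewrite -(inj_eq (@rperm_inj _ _ s)) Hs !rperm_rcomp.
  by apply/eqP/idP => /(rcomp_stableP _ nlow).
by rewrite /pair_alg big1 // => P _; rewrite none mulr0.
Qed.

(** Right orbits are nonempty, so for [s = 0] only [factors_below e S] remains. *)
Definition level s S : Prop :=
  factors_below e S \/
  exists Q : {set X * 'I_e}, exists2 V : {set 'I_e * X},
    S = rcomp Q V & (#|right_orbit Q| <= s)%N.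

Definition supported_on (D : relation X -> Prop) (x : A) : Prop :=
  forall S, x S <> 0 -> D S.

Lemma level_descent s x y :
  supported_on (level s.+1) x -> supported_on (level s.+1) y ->
  supported_on (level s) (x * a * y).
Proof.
move=> Hx Hy S nz; apply: NNPP => nS; case: nz.
rewrite -pair_alg_delta !pair_algM /pair_alg big1 // => S1 _.
have [->|/eqP/Hx H1] := eqVneq (x S1) 0; first by rewrite mul0r.
rewrite -[\sum_(P : relation X) _]/(pair_alg a (fun P =>
  pair_alg y (fun S2 => ((S1 * P * S2)%g == S)%:R))).
rewrite pair_alg_comm /pair_alg big1 ?mulr0 // => S2 _.
have [->|/eqP/Hy H2] := eqVneq (y S2) 0; first by rewrite mul0r.
rewrite -[\sum_(P : relation X) _]/(pair_alg a (fun P => ((S1 * P * S2)%g == S)%:R)).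
suff -> : pair_alg a (fun P => ((S1 * P * S2)%g == S)%:R) = 0 by rewrite mulr0.
have low P : factors_below e S1 \/ factors_below e S2 -> (S1 * P * S2)%g != S.
  move=> H; apply/negP => /eqP SE; apply: nS; left; rewrite -SE !rel_mulE.
  case: H => [H|H]; first exact/factors_below_rcompl/factors_below_rcompl.
  exact/factors_below_rcompr.
have zero : factors_below e S1 \/ factors_below e S2 ->
    pair_alg a (fun P => ((S1 * P * S2)%g == S)%:R) = 0.
  by move=> H; rewrite /pair_alg big1 // => P _; rewrite (negbTE (low P H)) mulr0.
case: H1 => [H1|[Q [V S1E muQ]]]; first by apply: zero; left.
case: H2 => [H2|[U [V' S2E _]]]; first by apply: zero; right.
have [lowQ|nlow] := classic (factors_below e Q).
  by apply: zero; left; rewrite S1E; apply: factors_below_rcompl.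
(* Group the [P] by [Y = Q V P U]. If [S = Y V'] is outside [level s], the right orbit of [Y] has
   more than [s] elements, at least as many as that of [Q], and [essential_annihilation] applies. *)
transitivity (pair_alg a (fun P => \sum_(Y : {set X * 'I_e})
    ((rcomp Y V' == S)%:R * (rcomp Q (rcomp V (rcomp P U)) == Y)%:R : k))).
  apply: eq_pair_alg => P; rewrite (bigD1 (rcomp Q (rcomp V (rcomp P U)))) //=.
  rewrite eqxx mulr1 big1 ?addr0 => [|Y /negbTE nY]; last first.
    by rewrite [_ == Y]eq_sym nY mulr0.
  by rewrite !rel_mulE S1E S2E !rcompA.
rewrite pair_alg_sum big1 // => Y _; rewrite pair_algZ.
have [YV|_] := eqVneq (rcomp Y V') S; last by rewrite mul0r.
rewrite essential_annihilation ?mulr0 //; apply: leq_trans muQ _.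
by rewrite ltnNge; apply/negP => muY; apply: nS; right; exists Y, V'.
Qed.

End Filtration.

Lemma factors_through_carrier S : factors_through #|X| S.
Proof.
exists [set p : X * 'I_#|X| | (p.1, enum_val p.2) \in S].
exists [set p : 'I_#|X| * X | enum_val p.1 == p.2].
apply/setP => -[z x]; apply/idP/rcompP => [zx|[i]].
  by exists (enum_rank x); rewrite inE /= enum_rankK.
by rewrite !inE /= => zi /eqP <-.
Qed.

(** Descent on [e], then on [s]: each use of [level_descent] replaces the exponent [m] by
    [2m + 1]. *)
Lemma annihilates_coefs_nilpotent a : annihilates_coefs a -> exists m, a ^+ m = 0.
Proof.
move=> Ha.
have key e : (e <= #|X|)%N -> forall s m, supported_on (level e s) (a ^+ m) ->
    exists m', a ^+ m' = 0.
  elim: e => [|e IHe] le_e.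
    elim=> [|s IHs] m Hm; last first.
      apply: (IHs (m + 1 + m)%N).
      by rewrite 2!exprD expr1; apply: level_descent.
    (* No relation is in [level 0 0], so the power vanishes. *)
    exists m; apply/ffunP => S; rewrite [RHS]ffunE; apply: NNPP => /Hm[[e' //]|].
    by case=> Q [V _]; have := right_orbit_gt0 Q; case: #|_|.
  elim=> [|s IHs] m Hm; last first.
    apply: (IHs (m + 1 + m)%N).
    by rewrite 2!exprD expr1; apply: level_descent.
  (* At [s = 0] only relations through at most [e] points remain; the new value of [s] bounds every
     right orbit. *)
  apply: (IHe (ltnW le_e) #|{set X * 'I_e}| m) => S /Hm[[e' lt [Q [V SE]]]|]; last first.
    by case=> Q [V _]; have := right_orbit_gt0 Q; case: #|_|.
  move: lt; rewrite ltnS leq_eqVlt => /predU1P[e'E|lt]; last first.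
    by left; exists e' => //; exists Q, V.
  by case: _ / e'E Q V SE => Q V SE; right; exists Q, V => //; rewrite max_card.
apply: (key _ (leqnn _) #|{set X * 'I_#|X|}| 0) => S _.
have [Q [V SE]] := factors_through_carrier S.
by right; exists Q, V => //; apply: max_card.
Qed.

End MatrixCoefficients.

(** * Nilpotency and the Jacobson radical *)

Section JacobsonRadical.

(** If [a] is outside [I], the left ideal [I + A a] contains [1], so [1 - b a] is in [I] for some
    [b]. A geometric sum inverts [1 - b a], which puts [1] in [I]. *)
Lemma nil_left_ideal_in_jacobson (A : nzRingType) (a : A) :
  (forall b, exists m, (b * a) ^+ m = 0) -> in_jacobson a.
Proof.
move=> nil I [[I0 I1 IM] Imax]; apply/negPn/negP => naI.
(* [P] describes [I + A a]; excluded middle turns it into a boolean predicate. *)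
pose P v := exists b, v - b * a \in I.
pose I' : {pred A} := fun v => if excluded_middle_informative (P v) then true else false.
have I'P v : reflect (P v) (v \in I').
  by rewrite unfold_in /I'; case: excluded_middle_informative => H; constructor.
have IB u v : u \in I -> v \in I -> u - v \in I.
  by move=> uI vI; rewrite addrC -mulN1r; apply: IM.
have ID u v : u \in I -> v \in I -> u + v \in I.
  by move=> uI vI; rewrite -[u]mul1r; apply: IM.
case: (classic (P 1)) => [[b H1]|nP1].
  have [m Hm] := nil b; case/negP: I1.
  have IMl c u : u \in I -> c * u \in I.
    by move=> uI; rewrite -[c * u]addr0; apply: IM.
  have : (\sum_(i < m) (b * a) ^+ i) * (1 - b * a) \in I by apply: IMl.
  suff -> n : (\sum_(i < n) (b * a) ^+ i) * (1 - b * a) = 1 - (b * a) ^+ n.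
    by rewrite Hm subr0.
  elim: n => [|n IHn]; first by rewrite big_ord0 mul0r expr0 subrr.
  by rewrite big_ord_recr /= mulrDl IHn mulrBr mulr1 -exprSr addrA subrK.
case/negP: naI; apply: (Imax I').
- split; first by apply/I'P; exists 0; rewrite mul0r subr0.
    exact/I'P.
  move=> c u v /I'P[b uI] /I'P[b' vI]; apply/I'P; exists (c * b + b').
  rewrite mulrDl opprD addrACA -mulrA -mulrBr; exact: IM.
- by move=> v vI; apply/I'P; exists 0; rewrite mul0r subr0.
- by apply/I'P; exists 1; rewrite mul1r subrr.
Qed.

Variables (k : fieldType) (A : falgType k).

(** Induction on the codimension: if a proper left ideal [I'] above [U] contains some [v] outside
    [U], then [U + A v] is a larger subspace inside [I'], hence still proper. *)
Lemma left_ideal_extends_to_maximal (U : {vspace A}) :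
  (forall b u, u \in U -> b * u \in U) -> 1 \notin U ->
  exists2 I : {pred A}, maximal_left_ideal I & {subset U <= I}.
Proof.
have [n le] := ubnP (\dim {:A} - \dim U)%N.
elim: n U le => // n IHn U le UM U1.
have IU : idealr_closed (fun x => x \in U).
  by split=> [||b u v uU vU]; rewrite ?mem0v ?rpredD ?UM.
case: (classic (forall I' : {pred A}, idealr_closed I' -> {subset U <= I'} -> {subset I' <= U})).
  by move=> max; exists (fun x => x \in U).
move=> /not_all_ex_not[I' nI']; have {nI'}[cI' nI'] := imply_to_and _ _ nI'.
have {nI'}[sUI' nI'] := imply_to_and _ _ nI'.
have [v nv] := not_all_ex_not _ _ nI'; have {nv}[vI' vU] := imply_to_and _ _ nv.
have [I'0 I'1 I'M] := cI'.
set W := (U + fullv * <[v]>)%VS.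
have sUW : (U <= W)%VS by apply: addvSl.
have sW : {subset W <= I'}.
  move=> x /memv_addP[u /sUI' uI' [w /memv_cosetP[b _ ->] ->]].
  by rewrite addrC; apply: I'M.
have vW : v \in W.
  apply: (subvP (addvSr _ _)); apply/memv_cosetP.
  by exists 1; rewrite ?memvf ?mul1r.
have ltUW : (\dim U < \dim W)%N.
  rewrite ltn_neqAle dimvS // andbT; apply/negP => /eqP eqd; apply: vU.
  by rewrite (eqP (_ : U == W)) // eqEdim sUW eqd leqnn.
have [||| I mI sI] := IHn W.
- rewrite -ltnS; apply: leq_trans le; rewrite ltnS ltn_sub2l //.
  by apply: leq_trans ltUW _; rewrite dimvS ?subvf.
- move=> b x /memv_addP[u uU [w /memv_cosetP[c _ ->] ->]].
  rewrite mulrDr mulrA; apply: memv_add; first exact: UM.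
  by apply/memv_cosetP; exists (b * c); rewrite ?memvf.
- by apply/negP => /sW; apply/negP.
by exists I => // x xU; apply/sI/(subvP sUW).
Qed.

(** Otherwise [A (1 - b a)] lies in a maximal left ideal, which contains [a] and therefore [1]. *)
Lemma jacobson_left_unit (a b : A) : in_jacobson a ->
  exists u, u * (1 - b * a) = 1.
Proof.
move=> Ja; case: (boolP (1 \in (fullv * <[1 - b * a]>)%VS)) => [|n1].
  by case/memv_cosetP => u _ E; exists u.
have [|I mI sI] := left_ideal_extends_to_maximal _ n1.
  move=> c x /memv_cosetP[u _ ->]; apply/memv_cosetP; exists (c * u); rewrite ?memvf //.
  by rewrite mulrA.
have aI := Ja _ mI; have [[I0 /negP nI1 IM] _] := mI; case: nI1.
rewrite -(subrK (b * a) 1) addrC; apply: (IM b _ _ aI); apply: sI.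
by apply/memv_cosetP; exists 1; rewrite ?memvf ?mul1r.
Qed.

(** With [x = b a], the left ideals [A x^m] stabilise, so [x^m = c x^(m+1)] for some [c]; then
    [1 - c x] is left invertible and kills [x^m]. *)
Lemma jacobson_nilpotent (a b : A) : in_jacobson a -> exists m, (b * a) ^+ m = 0.
Proof.
move=> Ja; set x := b * a; pose V m := (fullv * <[x ^+ m]>)%VS.
have decr m : (V m.+1 <= V m)%VS.
  apply/subvP => _ /memv_cosetP[u _ ->]; apply/memv_cosetP.
  by exists (u * x); rewrite ?memvf // exprS mulrA.
have [m eqV] : exists m, (V m <= V m.+1)%VS.
  have [n le] := ubnP (\dim (V 0%N)); move: 0%N le.
  elim: n => // n IHn m le; case: (boolP (V m <= V m.+1)%VS) => [|nle]; first by exists m.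
  apply: (IHn m.+1); rewrite -ltnS; apply: leq_trans le; rewrite ltnS ltn_neqAle dimvS // andbT.
  by apply: contra nle => /eqP eqd; rewrite (eqP (_ : V m == V m.+1)) // eq_sym eqEdim decr eqd leqnn.
have /(subvP eqV)/memv_cosetP[c _ xm] : x ^+ m \in V m.
  by apply/memv_cosetP; exists 1; rewrite ?memvf ?mul1r.
have [u Hu] := jacobson_left_unit (c * b) Ja; exists m.
have xm0 : (1 - c * b * a) * x ^+ m = 0.
  by rewrite mulrBl mul1r -(mulrA c b) -/x -mulrA -exprS -xm subrr.
by transitivity (u * (1 - c * b * a) * x ^+ m); [rewrite Hu mul1r | rewrite -mulrA xm0 mulr0].
Qed.

End JacobsonRadical.

(** As [X^m - M^m = X^m], the matrix [X - M] divides the scalar [X^m]. So the characteristic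
    polynomial is a power of [X], and its subleading coefficient, minus the trace, is zero. *)
Lemma nilpotent_trace (k : fieldType) n (M : 'M[k]_n.+1) m : M ^+ m = 0 -> \tr M = 0.
Proof.
move=> Mm.
pose Mx : 'M[{poly k}]_n.+1 := map_mx polyC M.
have HB : (('X)%:M - Mx) * (\sum_(i < m) ('X%:M) ^+ (m.-1 - i) * Mx ^+ i) = ('X^m)%:M.
  rewrite -subrXX_comm; last exact/esym/scalar_mxC.
  have -> : Mx ^+ m = map_mx polyC (M ^+ m) by rewrite rmorphXn.
  by rewrite Mm map_mx0 subr0 -rmorphXn.
have : char_poly M %| ('X - 0%:P) ^+ (m * n.+1).
  rewrite subr0 exprM -det_scalar -HB det_mulmx; exact: dvdp_mulIl.
case/dvdp_exp_XsubCP => j _; rewrite subr0 => eqp_X.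
have /eqP charM : char_poly M == 'X^j.
  by rewrite -eqp_monic ?char_poly_monic ?monicXn.
have jE : j = n.+1.
  by apply: succn_inj; rewrite -(size_polyXn k j) -charM size_char_poly.
have := char_poly_trace M (ltn0Sn n).
by rewrite charM jE coefXn /= (ltn_eqF (leqnn _)) => /esym/eqP; rewrite oppr_eq0 => /eqP.
Qed.

(** * The radical as the common kernel of the forms *)

Section JacobsonCoefs.
Variables (k : fieldType) (X : finType).
Hypothesis k_char0 : [pchar k] =i pred0.
Implicit Types a b : rel_alg k X.

Definition rel_alg_of (S : relation X) : rel_alg k X := [ffun P => (P == S)%:R : k^o].

Lemma pair_alg_of S (F : relation X -> k) : pair_alg (rel_alg_of S) F = F S.
Proof.
rewrite /pair_alg (bigD1 S) //= ffunE eqxx mul1r big1 ?addr0 // => P /negbTE nPS.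
by rewrite ffunE nPS mul0r.
Qed.

Section OneOrder.
Variables (E : finType) (R : {set E * E}) (V : {set E * X}) (U : {set X * E}).
Hypothesis ordR : is_order R.
(** In [V' P Z Q U'] this puts [R^op] between [V' P U] and [V Q U'], the shape that
    [between_decompose] splits. *)
Let Z : relation X := rcomp U (rcomp (rtr R) V).
Let z : rel_alg k X := rel_alg_of Z.

Lemma coefM a b V' U' :
  coef (a * (z * b)) R V' U' =
  \sum_(s in poset_aut R) coef a R V' (rperm s U) * coef b R (lperm s V) U'.
Proof.
rewrite /coef pair_algM.
transitivity (pair_alg a (fun P => pair_alg b (fun Q =>
    (between R (rcomp V' (rcomp (P * (Z * Q))%g U')))%:R : k))).
  by apply: eq_pair_alg => P; rewrite pair_algM pair_alg_of.
transitivity (pair_alg a (fun P => pair_alg b (fun Q => \sum_(s in poset_aut R)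
   (between R (rcomp V' (rcomp P (rperm s U))))%:R *
   (between R (rcomp (lperm s V) (rcomp Q U')))%:R : k))).
  apply: eq_pair_alg => P; apply: eq_pair_alg => Q.
  transitivity ((between R (rcomp (rcomp V' (rcomp P U))
      (rcomp (rtr R) (rcomp V (rcomp Q U')))))%:R : k).
    by rewrite !rel_mulE /Z !rcompA.
  rewrite between_decompose //; apply: eq_bigr => s _.
  by rewrite !rperm_rcomp lperm_rcomp.
rewrite /pair_alg; under eq_bigr => P _.
  under eq_bigr => Q _ do rewrite mulr_sumr.
  rewrite exchange_big /= mulr_sumr; over.
rewrite exchange_big /=; apply: eq_bigr => s _; rewrite mulr_suml; apply: eq_bigr => P _.
rewrite !mulr_sumr; apply: eq_bigr => Q _.
by rewrite !mulrA; congr (_ * _); rewrite -!mulrA; congr (_ * _); rewrite mulrC.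
Qed.

Lemma coef_perm a s V' U' : s \in poset_aut R ->
  coef a R (lperm s V') (rperm s U') = coef a R V' U'.
Proof.
move=> /poset_autP sA; apply: eq_pair_alg => P; congr (nat_of_bool _)%:R.
by rewrite -lperm_rcomp -rperm_rcomp -rperm_rcomp (between_conj _ sA).
Qed.

Lemma jacobson_coef a : in_jacobson a -> coef a R V U = 0.
Proof.
move=> Ja; have [n cardA] : exists n, #|poset_aut R| = n.+1.
  by exists #|poset_aut R|.-1; rewrite prednK // (cardG_gt0 [group of poset_aut R]).
pose g (i : 'I_n.+1) : {perm E} := enum_val (cast_ord (esym cardA) i).
have sum_g (F : {perm E} -> k) : \sum_(s in poset_aut R) F s = \sum_i F (g i).
  rewrite big_enum_val (reindex (cast_ord (esym cardA))) //=.
  by exists (cast_ord cardA) => i _; rewrite ?cast_ordK ?cast_ordKV.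
pose Y b : 'M[k]_n.+1 := \matrix_(i, j) coef b R (lperm (g i) V) (rperm (g j) U).
have YM b c : Y (b * (z * c)) = Y b * Y c.
  by apply/matrixP => i j; rewrite !mxE coefM sum_g; apply: eq_bigr => l _; rewrite !mxE.
have YX m : Y (a * (z * a) ^+ m) = Y a ^+ m.+1.
  elim: m => [|m IHm]; first by rewrite expr0 mulr1 expr1.
  by rewrite exprSr mulrA YM IHm -exprSr.
have [m za0] := jacobson_nilpotent z Ja.
have := @nilpotent_trace _ _ (Y a) m.+1; rewrite -YX za0 mulr0.
have Y0 : Y 0 = 0.
  by apply/matrixP => i j; rewrite !mxE /coef /pair_alg big1 // => P _; rewrite ffunE mul0r.
move=> /(_ Y0) trY; apply/eqP.
(* By [coef_perm] every diagonal entry of [Y a] equals [coef a R V U]. *)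
have : (n.+1%:R : k) * coef a R V U == 0.
  rewrite -trY /mxtrace mulr_natl -[X in _ *+ X]card_ord -sumr_const; apply/eqP.
  apply: eq_bigr => i _; rewrite mxE coef_perm //.
  by have := enum_valP (cast_ord (esym cardA) i).
by rewrite mulf_eq0 ((pcharf0P k).1 k_char0).
Qed.

End OneOrder.

Lemma jacobson_annihilates_coefsP a : in_jacobson a <-> annihilates_coefs a.
Proof.
split=> [Ja e _ R ordR V U|Ha]; first exact: jacobson_coef.
by apply: nil_left_ideal_in_jacobson => b; apply/annihilates_coefs_nilpotent/annihilates_coefs_mull.
Qed.

End JacobsonCoefs.

(** * Dimension of the quotient *)

(** A triangular matrix is inverted by induction on the weight: row [i] is cleared by the dual rows
    of smaller weight and divided by [M i i]. *)
Lemma triangular_dual_family (k : fieldType) (I : finType) (B : {set I})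
    (M : I -> I -> k) (w : I -> nat) :
  {in B, forall i, M i i != 0} ->
  {in B &, forall i j, M i j != 0 -> i = j \/ (w j < w i)%N} ->
  exists D : I -> I -> k,
    {in B &, forall i j, \sum_(l in B) D i l * M l j = (i == j)%:R}.
Proof.
move=> Mii Mij.
suff H i : exists D : I -> k, i \in B ->
    {in B, forall j, \sum_(l in B) D l * M l j = (i == j)%:R}.
  by have [D HD] := fin_all_exists H; exists D => i j iB jB; apply: HD.
have [n le] := ubnP (w i); elim: n i le => // n IHn i le_n.
case: (boolP (i \in B)) => iB; last by exists (fun=> 0).
have ex j : exists D : I -> k, (j \in B) && (w j < w i)%N ->
    {in B, forall j', \sum_(l in B) D l * M l j' = (j == j')%:R}.
  case: (boolP ((j \in B) && (w j < w i)%N)) => [/andP[jB lt]|_]; last by exists (fun=> 0).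
  by have [D HD] := IHn j (leq_trans lt le_n); exists D => _; apply: HD.
have [D HD] := fin_all_exists ex.
exists (fun l => (M i i)^-1 * ((l == i)%:R
   - \sum_(j | (j \in B) && (w j < w i)%N) M i j * D j l)) => _ j' j'B.
under eq_bigr => l _ do rewrite -mulrA mulrBl.
rewrite -mulr_sumr sumrB.
rewrite (bigD1 i) //= eqxx mul1r big1 ?addr0 => [|l /andP[_ /negbTE->]]; last by rewrite mul0r.
under [X in _ - X]eq_bigr => l _ do rewrite mulr_suml.
rewrite exchange_big /=.
have -> : \sum_(j | (j \in B) && (w j < w i)%N) \sum_(l in B) M i j * D j l * M l j' =
          \sum_(j | (j \in B) && (w j < w i)%N) M i j * (j == j')%:R.
  apply: eq_bigr => j Hj; rewrite -(HD j Hj j' j'B) mulr_sumr.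
  by apply: eq_bigr => l _; rewrite mulrA.
case: (boolP (w j' < w i)%N) => lt.
  rewrite (bigD1 j') ?j'B //= eqxx mulr1 big1 ?addr0 => [|j]; last first.
    by case/andP=> _ /negbTE->; rewrite mulr0.
  rewrite subrr mulr0; case: eqP => // ij; by rewrite ij ltnn in lt.
rewrite big1 => [|j /andP[jB ltj]]; last first.
  by case: eqP => [jj'|_]; rewrite ?mulr0 //; rewrite -jj' ltj in lt.
rewrite subr0; have [<-|nij] := eqVneq i j'; first by rewrite mulVf ?Mii.
case: (eqVneq (M i j') 0) => [->|/(Mij _ _ iB j'B)[ij|lt']]; first by rewrite mulr0.
  by rewrite ij eqxx in nij.
by rewrite lt' in lt.
Qed.

(** * Column bases and the action of automorphisms *)

Section ColumnAction.
Variables (X E : finType).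

(** The inverse makes a right action out of [rperm], which acts on the left by [rpermM]. *)
Definition rperm_act (U : {set X * E}) (s : {perm E}) : {set X * E} := rperm s^-1%g U.

Lemma rperm_act1 : rperm_act^~ 1%g =1 id.
Proof. by move=> U; rewrite /rperm_act invg1 rperm1. Qed.

Lemma rperm_actM U : act_morph rperm_act U.
Proof. by move=> s t; rewrite /rperm_act rpermM invMg. Qed.

Canonical rperm_action := TotalAction rperm_act1 rperm_actM.

End ColumnAction.

Section CoefBasis.
Variables (k : fieldType) (X E : finType) (R : {set E * E}).

Definition between_coef (V : {set E * X}) (U : {set X * E}) : k :=
  (between R (rcomp V U))%:R.

(* The columns of the matrix [between_coef] indexed by Bas form a basis of its
   column space, with dual family d. *)
Definition column_basis (Bas : {set {set X * E}}) (d : {set X * E} -> {set E * X} -> k) :=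
  [/\ forall s U, s \in poset_aut R -> U \in Bas -> rperm s U \in Bas,
      {in Bas &, forall B B', \sum_V d B V * between_coef V B' = (B == B')%:R}
    & forall V U, between_coef V U =
        \sum_(B in Bas) (\sum_V' d B V' * between_coef V' U) * between_coef V B].

Variables (Bas : {set {set X * E}}) (d : {set X * E} -> {set E * X} -> k).
Hypothesis ordR : is_order R.
Hypothesis basis : column_basis Bas d.
Let stab := let: And3 H _ _ := basis in H.
Let dual := let: And3 _ H _ := basis in H.
Let span := let: And3 _ _ H := basis in H.

Definition Bas_reps := orbit_transversal (rperm_action X E) (poset_aut R) Bas.

Lemma Bas_acts : [acts poset_aut R, on Bas | rperm_action X E]%g.
Proof.
apply/actsP => s sA U; apply/idP/idP => [H|]; last first.
  by apply: stab; rewrite groupV.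
have -> : U = rperm s (rperm s^-1 U) by rewrite rpermM mulgV rperm1.
exact: stab.
Qed.

(** A column with a dual vector satisfies [between R (V U)] for some [V]. If [s] fixes [U], this
    gives [s a <=_R a] for all [a], and the finite order of [s] forces equality. *)
Lemma Bas_free s U : s \in poset_aut R -> U \in Bas -> rperm s U = U -> s = 1%g.
Proof.
move=> sA UB sU; have /orderP[Rr Ra Rt] := ordR.
have [V bV] : exists V, between R (rcomp V U).
  apply/existsP; apply: contraT; rewrite negb_exists => /forallP H.
  have := dual UB UB; rewrite big1 ?eqxx => [/eqP|V _].
    by rewrite eq_sym oner_eq0.
  by rewrite /between_coef (negbTE (H V)) mulr0.
have /betweenP[H1 H2] := bV.
have le1 a : (s a, a) \in R.
  by apply: H2; rewrite -mem_rperm rperm_rcomp sU.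
have le m a : ((s ^+ m)%g a, a) \in R.
  elim: m a => [|m IHm] a; first by rewrite expg0 perm1.
  by rewrite expgS permM; apply: Rt (IHm _) (le1 _).
apply/permP => a; rewrite perm1; apply: Ra => //.
have := le #[s]%g.-1 (s a); rewrite -permM -expgS prednK ?order_gt0 //.
by rewrite expg_order perm1.
Qed.

Lemma Bas_repsP : [/\ Bas_reps \subset Bas,
   {in Bas_reps &, forall B B' s, s \in poset_aut R -> B' = rperm s B -> B = B' /\ s = 1%g} &
   forall B, B \in Bas -> exists2 s, s \in poset_aut R & rperm s B \in Bas_reps].
Proof.
have [_ sub H1 H2] := orbit_transversalP Bas_acts.
split=> // [B B' rB rB' s sA B'E|B /H2[s sA sB]]; last first.
  by exists s^-1%g; rewrite ?groupV.
have BB' : B = B'.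
  apply/eqP; rewrite -H1 //; apply/orbitP; exists s^-1%g; rewrite ?groupV //=.
  by rewrite /rperm_act invgK.
by split=> //; apply: (Bas_free sA (subsetP sub _ rB)); rewrite -B'E.
Qed.

Lemma card_Bas_reps : #|Bas| = (#|Bas_reps| * #|poset_aut R|)%N.
Proof.
have [tr _ _ _] := orbit_transversalP Bas_acts.
rewrite (card_transversal tr) -(acts_sum_card_orbit Bas_acts) -sum_nat_const.
apply: eq_bigr => _ /imsetP[U UB ->]; rewrite card_orbit.
suff -> : ('C_(poset_aut R)[U | rperm_action X E] = 1)%g by rewrite indexg1.
apply/trivgP/subsetP => s /setIP[sA /astab1P/= sU].
rewrite -groupV inE; apply/eqP; apply: (Bas_free _ UB sU); by rewrite groupV.
Qed.

(** Expanding the column [P C] in the basis settles all [V] for representatives [C]; automorphisms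
    carry this to all basis columns, and expanding [U] to all [U]. *)
Lemma coef_vanish (a : rel_alg k X) :
  (forall C' C, C' \in Bas -> C \in Bas_reps -> \sum_V d C' V * coef a R V C = 0) ->
  forall V U, coef a R V U = 0.
Proof.
move=> H; have [_ _ ex_rep] := Bas_repsP.
have H1 V C : C \in Bas_reps -> coef a R V C = 0.
  move=> rC; transitivity (pair_alg a (fun P => \sum_(B : {set X * E}) \sum_(V' : {set E * X})
      (if B \in Bas then d B V' * between_coef V B else 0) * between_coef V' (rcomp P C))).
    apply: eq_pair_alg => P; rewrite -[LHS]/(between_coef V (rcomp P C)) span big_mkcond.
    apply: eq_bigr => B _; case: (B \in Bas); last by rewrite big1 // => V' _; rewrite mul0r.
    by rewrite mulr_suml; apply: eq_bigr => V' _; rewrite mulrAC.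
  rewrite pair_alg_sum big1 // => B _; rewrite pair_alg_sum.
  case: (boolP (B \in Bas)) => BB; last by rewrite big1 // => V' _; rewrite pair_algZ mul0r.
  transitivity (between_coef V B * \sum_V' d B V' * coef a R V' C); last by rewrite H ?mulr0.
  by rewrite mulr_sumr; apply: eq_bigr => V' _; rewrite pair_algZ mulrCA mulrA.
have H2 V B : B \in Bas -> coef a R V B = 0.
  by move=> /ex_rep[s sA rB]; rewrite -(coef_perm a V B sA) H1.
move=> V U; transitivity (pair_alg a (fun P => \sum_(B : {set X * E})
   (if B \in Bas then \sum_V' d B V' * between_coef V' U else 0) *
      between_coef (rcomp V P) B)).
  apply: eq_pair_alg => P; rewrite rcompA -[LHS]/(between_coef (rcomp V P) U) span.
  by rewrite big_mkcond; apply: eq_bigr => B _; case: ifP => // _; rewrite mul0r.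
rewrite pair_alg_sum big1 // => B _; rewrite pair_algZ.
case: (boolP (B \in Bas)) => BB; last by rewrite mul0r.
have <- : coef a R V B = pair_alg a (fun P => between_coef (rcomp V P) B).
  by apply: eq_pair_alg => P; rewrite /between_coef rcompA.
by rewrite H2 // mulr0.
Qed.

End CoefBasis.

(** * Representatives of the classes of orders *)

Section OrderRepresentatives.
Variables (E : finType) (Rs : {set {set E * E}}).
Hypothesis Rs_reps : order_representatives Rs.

Lemma mem_setact_pair (s : {perm E}) (R : {set E * E}) x y :
  ((s x, s y) \in (pair_action E)^*%act R s) = ((x, y) \in R).
Proof.
rewrite /= setactE; apply/imsetP/idP => [[[x' y'] xy' [/perm_inj-> /perm_inj->]] //|xy].
by exists (x, y).
Qed.

Lemma Rs_order R : R \in Rs -> is_order R.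
Proof. by move=> /(subsetP (transversal_sub Rs_reps)); rewrite inE. Qed.

Lemma Rs_class R : is_order R -> exists2 R', R' \in Rs &
  exists s : {perm E}, forall x y, ((s x, s y) \in R') = ((x, y) \in R).
Proof.
move=> ordR; have /and3P[_ _ /forallP H] := Rs_reps.
set B := orbit (pair_action E)^*%act [set: {perm E}]%g R.
have BP : B \in order_classes E by apply: imset_f; rewrite inE.
have /implyP/(_ BP)/cards1P[R' RR'] := H B.
have /setIP[R'Rs /orbitP[s _ sR]] : R' \in Rs :&: B by rewrite RR' inE.
by exists R' => //; exists s => x y; rewrite -sR mem_setact_pair.
Qed.

Lemma Rs_uniq R R' (s : {perm E}) : R \in Rs -> R' \in Rs ->
  (forall x y, ((s x, s y) \in R') = ((x, y) \in R)) -> R = R'.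
Proof.
move=> RRs R'Rs Hs; have ordR := Rs_order RRs; have /and3P[_ _ /forallP H] := Rs_reps.
set B := orbit (pair_action E)^*%act [set: {perm E}]%g R.
have BP : B \in order_classes E by apply: imset_f; rewrite inE.
have /implyP/(_ BP)/cards1P[R0 RR0] := H B.
have /set1P -> : R \in [set R0] by rewrite -RR0 inE RRs orbit_refl.
suff /set1P -> : R' \in [set R0] by [].
rewrite -RR0 inE R'Rs; apply/orbitP; exists s => //.
apply/setP => -[x y]; have := mem_setact_pair s R (s^-1%g x) (s^-1%g y).
by rewrite !permKV => ->; rewrite -Hs !permKV.
Qed.

End OrderRepresentatives.

(** * Independence of the forms and the dimension count *)

Section Dimension.
Variables (k : fieldType) (X : finType).
Let n := #|X|.
Variable Rs : forall e : nat, {set {set 'I_e * 'I_e}}.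
Hypothesis Rs_reps : forall e, order_representatives (Rs e).
Variable Bas : forall e, {set 'I_e * 'I_e} -> {set {set X * 'I_e}}.
Variable d : forall e, {set 'I_e * 'I_e} -> {set X * 'I_e} -> {set 'I_e * X} -> k.
Hypothesis basis : forall e R, R \in Rs e -> column_basis R (Bas R) (d R).

Lemma coefs_Rs_annihilate (a : rel_alg k X) :
  (forall e, (e <= n)%N -> forall R, R \in Rs e -> forall V U, coef a R V U = 0) ->
  annihilates_coefs a.
Proof.
move=> H e le_e R0 ordR0 V U; have [R RRs [s Hs]] := Rs_class (Rs_reps e) ordR0.
rewrite -(H e le_e R RRs (lperm s^-1%g V) (rperm s^-1%g U)).
apply: eq_pair_alg => P; congr (nat_of_bool _)%:R.
rewrite -(between_conj _ Hs) !rperm_rcomp lperm_rcomp lpermM mulgV lperm1.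
by rewrite rpermM mulgV rperm1.
Qed.

(** The coordinate at the basis column [C'] of the vector [V |-> coef a R V C]. *)
Definition zeta e (R : {set 'I_e * 'I_e}) C' C (a : rel_alg k X) : k :=
  \sum_V d R C' V * coef a R V C.

(** The factor [R^op] between [B'] and [V] lets [between_decompose] separate the two indices when
    [zeta] is evaluated here. *)
Definition test_element e (R : {set 'I_e * 'I_e}) B' B : rel_alg k X :=
  \sum_V d R B V *: rel_alg_of k (rcomp B' (rcomp (rtr R) V) : relation X).

Lemma pair_alg_lin (I : finType) (c : I -> k) (x : I -> rel_alg k X) F :
  pair_alg (\sum_i c i *: x i) F = \sum_i c i * pair_alg (x i) F.
Proof.
rewrite /pair_alg; under eq_bigr => P _ do rewrite sum_ffunE mulr_suml.
rewrite exchange_big; apply: eq_bigr => i _; rewrite mulr_sumr.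
by apply: eq_bigr => P _; rewrite ffunE mulrA.
Qed.

Lemma zeta_lin (I : finType) (c : I -> k) (x : I -> rel_alg k X) e (R : {set 'I_e * 'I_e}) C' C :
  zeta R C' C (\sum_i c i *: x i) = \sum_i c i * zeta R C' C (x i).
Proof.
rewrite /zeta; under eq_bigr => V _ do rewrite /coef pair_alg_lin mulr_sumr.
rewrite exchange_big; apply: eq_bigr => i _; rewrite mulr_sumr.
by apply: eq_bigr => V _; rewrite mulrCA.
Qed.

Lemma zeta_test e e1 (R : {set 'I_e * 'I_e}) (R1 : {set 'I_e1 * 'I_e1}) B' B C' C :
  zeta R1 C' C (test_element R B' B) =
  \sum_V \sum_V' d R1 C' V * (d R B V' *
    (between R1 (rcomp (rcomp V B') (rcomp (rtr R) (rcomp V' C))))%:R).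
Proof.
apply: eq_bigr => V _; rewrite /coef pair_alg_lin mulr_sumr; apply: eq_bigr => V' _.
by rewrite pair_alg_of !rcompA.
Qed.

(** [between_decompose] gives a sum over automorphisms of products of two Kronecker deltas; since
    [Aut(E, R)] acts freely and [B], [C] are orbit representatives, only [s = 1] can contribute. *)
Lemma zeta_test_same e (R : {set 'I_e * 'I_e}) B' B C' C : R \in Rs e ->
  B' \in Bas R -> B \in Bas_reps R (Bas R) -> C' \in Bas R -> C \in Bas_reps R (Bas R) ->
  zeta R C' C (test_element R B' B) = ((C' == B') && (C == B))%:R.
Proof.
move=> RRs B'B rB C'B rC; have ordR := Rs_order (Rs_reps e) RRs.
have bas := basis RRs; have [stab dual _] := bas.
have [/subsetP sub uniq _] := Bas_repsP ordR bas.
transitivity (\sum_(s in poset_aut R) ((C' == rperm s B') && (B == rperm s^-1%g C))%:R : k).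
  rewrite zeta_test.
  transitivity (\sum_(s in poset_aut R) (\sum_V d R C' V * between_coef k R V (rperm s B'))
     * (\sum_V' d R B V' * between_coef k R V' (rperm s^-1%g C))).
    under eq_bigr => V _.
      under eq_bigr => V' _ do rewrite between_decompose // !mulr_sumr.
      rewrite exchange_big /=; over.
    rewrite exchange_big /=; apply: eq_bigr => s /poset_autP As.
    rewrite mulr_suml; apply: eq_bigr => V _; rewrite mulr_sumr; apply: eq_bigr => V' _.
    rewrite rperm_rcomp /between_coef -(between_conj (rcomp V' (rperm s^-1%g C)) As).
    rewrite [rperm s (rcomp V' _)]rperm_rcomp rpermM mulgV rperm1.
    by rewrite -!mulrA; congr (_ * _); rewrite mulrCA.
  apply: eq_bigr => s sA; have [BB CB] := (sub _ rB, sub _ rC).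
  by rewrite !dual ?stab ?groupV // -natrM mulnb.
case: (boolP (_ && _)) => [/andP[/eqP-> /eqP->]|nE].
  rewrite (bigD1 1%g) ?group1 //= rperm1 invg1 rperm1 !eqxx big1 ?addr0 //.
  move=> s /andP[sA /negbTE s1]; case: eqP => //= _; case: eqP => // BE.
  have [_ /eqP] := uniq _ _ rB rB _ (groupVr sA) BE.
  by rewrite invg_eq1 s1.
rewrite big1 // => s sA; case: eqP => //= C'E; case: eqP => // BE.
have [CB /eqP] := uniq _ _ rC rB _ (groupVr sA) BE; rewrite invg_eq1 => /eqP s1.
by move: nE; rewrite C'E s1 rperm1 CB !eqxx.
Qed.

Definition coef_index :=
  {e : 'I_n.+1 & ({set 'I_e * 'I_e} * ({set X * 'I_e} * {set X * 'I_e}))%type}.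

(** Only the second column is restricted to orbit representatives, since [coef] is invariant under
    simultaneous moves of both arguments. *)
Definition coef_indices : {set coef_index} :=
  [set w : coef_index | [&& (tagged w).1 \in Rs (tag w), (tagged w).2.1 \in Bas (tagged w).1
     & (tagged w).2.2 \in Bas_reps (tagged w).1 (Bas (tagged w).1)]].

Definition zeta_at (w : coef_index) : rel_alg k X -> k :=
  zeta (tagged w).1 (tagged w).2.1 (tagged w).2.2.

Definition test_at (w : coef_index) : rel_alg k X :=
  test_element (tagged w).1 (tagged w).2.1 (tagged w).2.2.

(** Lexicographic: first [e], then the number of pairs missing from [R] relative to [n ^ 2], which
    stays below the factor of [e]. *)
Definition index_weight (w : coef_index) : nat :=
  (tag w * (n ^ 2).+1 + (n ^ 2 - #|(tagged w).1|))%N.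

(** A nonzero value gives, by [between_factor], an injection of ['I_e1] into ['I_e] that pulls [R]
    back into [R1]. So [e1 <= e]; if [e1 = e], then [R1] has at least as many pairs as [R], and
    equality makes the orders conjugate, hence equal. *)
Lemma zeta_test_triangular : {in coef_indices &, forall v w,
  zeta_at w (test_at v) != 0 -> v = w \/ (index_weight w < index_weight v)%N}.
Proof.
case=> e [R [B' B]] [e1 [R1 [C' C]]]; rewrite !inE /=.
move=> /and3P[RRs B'B rB] /and3P[R1Rs C'B rC]; rewrite /zeta_at /test_at /index_weight /=.
have card_le (e0 : 'I_n.+1) (R0 : {set 'I_e0 * 'I_e0}) : (#|R0| <= n ^ 2)%N.
  apply: leq_trans (max_card _) _; rewrite card_prod !card_ord mulnn leq_sqr.
  by rewrite -ltnS ltn_ord.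
have [lt|] := ltnP e1 e.
  move=> _; right; apply: leq_trans (_ : e1.+1 * (n ^ 2).+1 <= _)%N.
    by rewrite mulSn addnC ltn_add2r ltnS leq_subr.
  by apply: leq_trans (leq_addr _ _); rewrite leq_mul2r lt orbT.
move=> le_e nz.
have [V [V' bVV']] : exists V V', between R1 (rcomp (rcomp V B') (rcomp (rtr R) (rcomp V' C))).
  apply: NNPP => nex; move: nz; rewrite zeta_test big1 ?eqxx // => V _.
  rewrite big1 // => V' _; rewrite (_ : between _ _ = false) ?mulr0 //.
  by apply/negP => b; apply: nex; exists V, V'.
have ordR := Rs_order (Rs_reps e) RRs; have ordR1 := Rs_order (Rs_reps e1) R1Rs.
have [s [s_inj s_refl _ _]] := between_factor ordR ordR1 bVV'.
have /eqP ee : e1 == e.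
  by rewrite -val_eqE /= eqn_leq le_e andbT; have := leq_card s s_inj; rewrite !card_ord.
case: _ / ee R B' B RRs B'B rB s s_inj s_refl nz ordR V V' bVV' le_e => R B' B RRs B'B rB
  s s_inj s_refl nz ordR _ _ _ _.
have s_refl' a b : (perm s_inj a, perm s_inj b) \in R -> (a, b) \in R1.
  by rewrite !permE; apply: s_refl.
have [leR|ltR] := leqP #|R1| #|R|.
  have RR1 : R1 = R.
    apply: (Rs_uniq (Rs_reps e1) R1Rs RRs (s := perm s_inj)).
    exact: perm_reflects_order.
  case: _ / RR1 B' B RRs B'B rB nz {s_refl s_refl' ordR leR} => B' B RRs B'B rB nz.
  left; move: nz; rewrite zeta_test_same //.
  by case: (C' =P B') => [->|_]; case: (C =P B) => [->|_]; rewrite ?eqxx.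
right; rewrite ltn_add2l ltn_sub2l //; exact: leq_trans ltR (card_le _ _).
Qed.

Lemma zeta_dual_family : exists x : coef_index -> rel_alg k X,
  {in coef_indices &, forall v w, zeta_at w (x v) = (v == w)%:R}.
Proof.
have [|D HD] := @triangular_dual_family k _ coef_indices
    (fun v w => zeta_at w (test_at v)) index_weight _ zeta_test_triangular.
  move=> w; rewrite inE => /and3P[RRs B'B rB].
  by rewrite /zeta_at /test_at zeta_test_same // !eqxx oner_eq0.
exists (fun v => \sum_w (if w \in coef_indices then D v w else 0) *: test_at w).
move=> v w vO wO; rewrite /zeta_at zeta_lin -(HD v w vO wO) [RHS]big_mkcond.
by apply: eq_bigr => l _; case: ifP => // _; rewrite mul0r.
Qed.

Lemma zeta_atP w c a b : zeta_at w (c *: a + b) = c * zeta_at w a + zeta_at w b.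
Proof.
have pairP F : pair_alg (c *: a + b) F = c * pair_alg a F + pair_alg b F.
  rewrite /pair_alg mulr_sumr -big_split; apply: eq_bigr => P _.
  by rewrite 2!ffunE mulrDl mulrA.
rewrite /zeta_at /zeta mulr_sumr -big_split; apply: eq_bigr => V _.
by rewrite /coef pairP mulrDr mulrCA.
Qed.

Definition zeta_map (a : rel_alg k X) : {ffun {w | w \in coef_indices} -> k^o} :=
  [ffun w => zeta_at (val w) a].

Lemma zeta_map_linear : linear zeta_map.
Proof.
move=> c a b; apply/ffunP => w; rewrite [LHS]ffunE zeta_atP.
by rewrite [RHS]ffunE; congr (_ + _); rewrite [RHS]ffunE // [zeta_map a w]ffunE.
Qed.

HB.instance Definition _ := GRing.isLinear.Build _ _ _ _ zeta_map zeta_map_linear.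

(** [J] is the kernel of [zeta_map], which is surjective by the dual family; rank and nullity do the
    rest. *)
Lemma annihilator_dim : exists J : {vspace rel_alg k X},
  (forall a, a \in J <-> annihilates_coefs a) /\
  (\dim J + #|coef_indices| = 2 ^ (n ^ 2))%N.
Proof.
exists (lker (linfun zeta_map)); split=> [a|].
  rewrite memv_ker lfunE; split=> [/eqP/ffunP Z0|Ha].
    apply: coefs_Rs_annihilate => e le_e R RRs.
    apply: (coef_vanish (Rs_order (Rs_reps e) RRs) (basis RRs)) => C' C C'B rC.
    have lt_e : (e < n.+1)%N by [].
    have wO : (existT _ (Ordinal lt_e) (R, (C', C)) : coef_index) \in coef_indices.
      by rewrite inE /= RRs C'B.
    by have := Z0 (exist (fun w : coef_index => w \in coef_indices) _ wO); rewrite !ffunE.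
  have Z0 w : zeta_map a w = 0.
    rewrite ffunE /zeta_at /zeta big1 // => V _.
    have := valP w; rewrite inE => /and3P[RRs _ _].
    by rewrite Ha ?mulr0 // ?(Rs_order (Rs_reps _) RRs) // -ltnS.
  by apply/eqP/ffunP => w; rewrite Z0 [RHS]ffunE.
have [x Hx] := zeta_dual_family.
have full : limg (linfun zeta_map) = fullv.
  apply/eqP; rewrite eqEsubv subvf; apply/subvP => y _.
  suff -> : y = linfun zeta_map (\sum_w y w *: x (val w)) by apply/memv_img/memvf.
  rewrite lfunE; apply/ffunP => w; rewrite ffunE /zeta_at zeta_lin.
  rewrite (bigD1 w) //= -/(zeta_at _ _) Hx ?eqxx ?mulr1 ?(valP w) //.
  rewrite big1 ?addr0 // => v /negbTE nvw; rewrite -/(zeta_at _ _) Hx ?(valP v) ?(valP w) //.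
  by rewrite val_eqE nvw mulr0.
have := limg_ker_dim (linfun zeta_map) fullv; rewrite capfv full !dimvf.
rewrite /dim /= !muln1 card_sig => ->.
by rewrite -cardsT -powersetT card_powerset cardsT card_prod mulnn.
Qed.

Lemma card_coef_indices :
  (#|coef_indices|%:R = \sum_(e < n.+1) \sum_(R in Rs e)
      (#|poset_aut R|%:R)^-1 * #|Bas R|%:R ^+ 2 :> rat).
Proof.
transitivity (\sum_(e < n.+1) \sum_(R in Rs e) (#|Bas R| * #|Bas_reps R (Bas R)|)%:R : rat).
  under [RHS]eq_bigr => e _ do rewrite -natr_sum; rewrite -natr_sum.
  congr _%:R; rewrite -sum1_card.
  transitivity (\sum_(e < n.+1) \sum_(x : {set 'I_e * 'I_e} * ({set X * 'I_e} * {set X * 'I_e})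
      | [&& x.1 \in Rs e, x.2.1 \in Bas x.1 & x.2.2 \in Bas_reps x.1 (Bas x.1)]) 1)%N.
    by rewrite sig_big_dep /=; apply: eq_bigl => w; rewrite inE.
  apply: eq_bigr => e _; rewrite -(pair_big_dep (fun R => R \in Rs e)
    (fun R (BB : {set X * 'I_e} * {set X * 'I_e}) =>
      (BB.1 \in Bas R) && (BB.2 \in Bas_reps R (Bas R)))
    (fun _ _ => 1%N)) /=.
  apply: eq_bigr => R _; rewrite -cardsX -sum1_card; apply: eq_bigl => -[B' B].
  by rewrite inE.
apply: eq_bigr => e _; apply: eq_bigr => R RRs.
have nz : (#|poset_aut R|%:R : rat) != 0.
  by rewrite Num.Theory.pnatr_eq0 -lt0n (cardG_gt0 [group of poset_aut R]).
rewrite natrM (card_Bas_reps (Rs_order (Rs_reps e) RRs) (basis RRs)) natrM expr2.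
by rewrite [_ * #|poset_aut R|%:R]mulrC !mulrA mulVf // mul1r [_ * #|poset_aut R|%:R]mulrC.
Qed.

End Dimension.

(** * Irreducible elements of a finite lattice *)

Section IrreducibleElements.
Import Order.TTheory.
Local Open Scope order_scope.
Variables (disp : Order.disp_t) (T : finTBLatticeType disp).
Implicit Types (s t p e : T) (A : {set T}).

Lemma IrrP e : reflect (forall A, e = \join_(a in A) a -> e \in A) (e \in Irr T).
Proof.
rewrite inE; apply: (iffP forallP) => H A; first by move=> eA; have := H A; rewrite -eA eqxx.
by apply/implyP => /eqP; apply: H.
Qed.

Definition coheight t : nat := #|[set s | t <= s]|.

Lemma coheight_lt s t : s < t -> (coheight t < coheight s)%N.
Proof.
move=> st; apply/proper_card/properP; split.
  by apply/subsetP => u; rewrite !inE; apply/le_trans/ltW.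
by exists s; rewrite !inE ?lexx // lt_geF.
Qed.

Definition height t : nat := #|[set s | s <= t]|.

Lemma height_lt s t : s < t -> (height s < height t)%N.
Proof.
move=> st; apply/proper_card/properP; split.
  by apply/subsetP => u; rewrite !inE => /le_trans; apply; apply: ltW.
by exists t; rewrite !inE ?lexx // lt_geF.
Qed.

Lemma reducible_join t : t \notin Irr T ->
  exists2 A : {set T}, t = \join_(a in A) a & forall a, a \in A -> a < t.
Proof.
rewrite inE negb_forall => /existsP[A]; rewrite negb_imply => /andP[/eqP tA nA].
exists A => // a aA; rewrite lt_neqAle; apply/andP; split.
  by apply: contraNneq nA => <-.
by rewrite tA; apply: (joins_sup id).
Qed.

Lemma le_Irr s t : (forall e, e \in Irr T -> e <= s -> e <= t) -> s <= t.
Proof.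
have [n le_n] := ubnP (height s); elim: n s le_n => // n IHn s le_n H.
case: (boolP (s \in Irr T)) => [sI|/reducible_join[A sA ltA]]; first exact: H.
rewrite [s]sA; apply/joinsP => a aA; apply: IHn => [|e eI ea].
  by rewrite -ltnS (leq_trans _ le_n) // ltnS; apply/height_lt/ltA.
by apply: H => //; apply: le_trans ea (ltW (ltA _ aA)).
Qed.

Lemma rdown_lt e : e \in Irr T -> rdown e < e.
Proof.
move=> /IrrP eI; rewrite lt_neqAle rdown_le andbT; apply/eqP => E.
have := eI [set s | s < e]; rewrite inE ltxx => F.
suff : false by []; apply: F; rewrite -[LHS]E /rdown.
by apply: eq_bigl => s; rewrite inE.
Qed.

Lemma le_rdown s t : s < t -> s <= rdown t.
Proof. by move=> st; rewrite /rdown; apply: (joins_sup id). Qed.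

Lemma rdown_reducible t : t \notin Irr T -> rdown t = t.
Proof.
move=> /reducible_join[A tA ltA]; apply/eqP; rewrite eq_le rdown_le [X in X <= _]tA.
by apply/joinsP => a /ltA; apply: le_rdown.
Qed.

Lemma le_sigmaP s t :
  reflect (forall e, e \in Irr T -> t < e -> s <= e) (s <= sigma t).
Proof.
rewrite /sigma; apply: (iffP (meetsP _ _ _)) => H e; first by move=> eI te; apply: H; rewrite eI.
by case/andP; apply: H.
Qed.

Lemma sigma_ge t : t <= sigma t.
Proof. by apply/le_sigmaP => e _ /ltW. Qed.

Lemma sigma_le t e : e \in Irr T -> t < e -> sigma t <= e.
Proof. by move=> eI te; have /le_sigmaP := lexx (sigma t); apply. Qed.

(** The condition on [s] means that [s] lies below the meet of all irreducibles above [t]. *)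
Lemma Lambda_IrrP t :
  reflect (forall s, (forall e, e \in Irr T -> t <= e -> s <= e) -> s <= t)
          (t \in Lambda_Irr T).
Proof.
apply: (iffP imsetP) => [[A] |H].
  rewrite powersetE => /subsetP AI -> s Hs; apply/meetsP => a aA.
  by apply: Hs (AI _ aA) _; apply: (meets_inf id).
exists [set e in Irr T | t <= e].
  by rewrite powersetE; apply/subsetP => e; rewrite inE => /andP[].
apply/eqP; rewrite eq_le; apply/andP; split.
  by apply/meetsP => e; rewrite inE => /andP[].
by apply: H => e eI te; apply: (meets_inf id); rewrite inE eI.
Qed.

Lemma Irr_Lambda e : e \in Irr T -> e \in Lambda_Irr T.
Proof. by move=> eI; apply/Lambda_IrrP => s; apply. Qed.

Lemma lt_Irr_reducible t e : t \notin Irr T -> e \in Irr T -> (t < e) = (t <= e).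
Proof. by move=> nI eI; rewrite lt_neqAle; case: eqP nI => // ->; rewrite eI. Qed.

Lemma Lambda_reducible t : t \notin Irr T -> (t \in Lambda_Irr T) = (sigma t == t).
Proof.
move=> nI; apply/Lambda_IrrP/eqP => [H|E s Hs].
  apply/eqP; rewrite eq_le sigma_ge andbT; apply: H => e eI te.
  by apply: sigma_le; rewrite ?lt_Irr_reducible.
rewrite -[X in _ <= X]E; apply/le_sigmaP => e eI te; apply: Hs => //; exact: ltW.
Qed.

(* Follow the chain p < sigma p < sigma (sigma p) < ... as long as its new member
   is irreducible and has the previous one as its rdown.  [up p]: the chain ends in
   an irreducible fixed point of sigma; [good p]: it breaks off before.  The
   elements of G_hat are the reducible [up] elements outside Lambda_Irr. *)
Inductive up : T -> Prop :=
| up_fixed p : p \in Irr T -> sigma p = p -> up p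
| up_step p : sigma p \in Irr T -> rdown (sigma p) = p -> up (sigma p) -> up p.

Inductive good : T -> Prop :=
| good_last p s : p < s -> (forall e, e \in Irr T -> (s <= e) = (p < e)) ->
    s \notin Irr T -> good p
| good_step p s : p < s -> (forall e, e \in Irr T -> (s <= e) = (p < e)) ->
    good s -> good p.

Lemma sigma_up_good p : [\/ sigma p = p, up p | good p].
Proof.
have [n le_n] := ubnP (coheight p); elim: n p le_n => // n IHn p le_n.
have [->|np] := eqVneq (sigma p) p; first by constructor 1.
have ltp : p < sigma p by rewrite lt_neqAle eq_sym np sigma_ge.
have sigmaE e : e \in Irr T -> (sigma p <= e) = (p < e).
  by move=> eI; apply/idP/idP => [|/sigma_le]; [apply: lt_le_trans | apply].
have [cI|] := boolP (sigma p \in Irr T); last by constructor 3; apply: (good_last ltp).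
have [rp|nr] := eqVneq (rdown (sigma p)) p.
  case: (IHn (sigma p)) => [|fix_p|up_p|good_p].
  - by rewrite -ltnS (leq_trans _ le_n) // ltnS; apply: coheight_lt.
  - by constructor 2; apply: up_step => //; apply: up_fixed.
  - by constructor 2; apply: up_step.
  - by constructor 3; apply: (good_step ltp).
(* Now [rdown (sigma p)] lies strictly between [p] and [sigma p]. It is reducible, since every
   irreducible above [p] is above [sigma p]. *)
constructor 3; have ltr : p < rdown (sigma p) by rewrite lt_neqAle eq_sym nr le_rdown.
apply: (good_last ltr) => [e eI|].
  apply/idP/idP => [|pe]; first exact: lt_le_trans.
  by apply: le_trans (rdown_le _) _; rewrite sigmaE.
apply/negP => rI; have := sigmaE _ rI; rewrite ltr.
by rewrite lt_geF // rdown_lt.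
Qed.

(** If [p] is irreducible, everything strictly below [p] is below [rdown p]. So either [sigma] fixes
    [rdown p], or it sends [rdown p] back to [p], which extends the chain downwards. *)
Lemma up_rdown e j : e \in Irr T -> sigma e = e ->
  sigma (iter j (@rdown _ T) e) = iter j (@rdown _ T) e \/ up (iter j (@rdown _ T) e).
Proof.
move=> eI fix_e; elim: j => [|j IHj]; first by left.
rewrite iterS; set p := iter j _ e in IHj *.
have [pI|nI] := boolP (p \in Irr T); last by rewrite rdown_reducible.
have up_p : up p by case: IHj => // fix_p; apply: up_fixed.
have [->|nr] := eqVneq (sigma (rdown p)) (rdown p); [by left | right].
have rE : sigma (rdown p) = p.
  apply/eqP; rewrite eq_le sigma_le ?rdown_lt //=.
  apply: contraT => np; have lt : sigma (rdown p) < p.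
    rewrite lt_neqAle sigma_le ?rdown_lt // andbT.
    by apply: contraNneq np => ->.
  by move: nr; rewrite eq_le sigma_ge le_rdown.
by apply: up_step; rewrite rE.
Qed.

Lemma up_iter_rdown p : up p -> exists e j,
  [/\ e \in Irr T, sigma e = e & p = iter j (@rdown _ T) e].
Proof.
elim=> {p} [p pI fix_p|p _ rp _ [e [j [eI fix_e pE]]]]; first by exists p, 0%N.
by exists e, j.+1; split; rewrite // iterS -pE.
Qed.

(** This trades the iterates in [G_hat] for chains: [rdown] fixes a reducible [t], so reaching [t]
    after [j] steps or after [#|T|] steps is the same. *)
Lemma G_setP t : reflect (t \in Lambda_Irr T \/ t \notin Irr T /\ up t) (t \in G_set T).
Proof.
rewrite /G_set in_setU; apply: (iffP orP).
  case=> [|]; first by left.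
  rewrite inE => /andP[nL /existsP[e /andP[eI /andP[/eqP tE /eqP fix_e]]]].
  have nI : t \notin Irr T by apply: contra nL; apply: Irr_Lambda.
  right; split=> //; rewrite tE; case: (up_rdown #|T| eI fix_e) => // fix_t.
  by move: nL; rewrite Lambda_reducible // tE /rdown_inf fix_t eqxx.
case=> [|[nI up_t]]; first by left.
have [tL|nL] := boolP (t \in Lambda_Irr T); first by left.
right; rewrite inE nL; have [e [j [eI fix_e tE]]] := up_iter_rdown up_t.
apply/existsP; exists e; rewrite eI fix_e eqxx andbT.
have fix_iter s m : rdown s = s -> iter m (@rdown _ T) s = s.
  by move=> fix_s; elim: m => //= m ->.
rewrite -[X in X == _](fix_iter _ #|T|); last exact: rdown_reducible.
rewrite [X in iter _ _ X]tE -iterD addnC iterD -/(rdown_inf e).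
by rewrite fix_iter ?eqxx //; apply: rdown_infP.
Qed.

Lemma up_sigma p : up p -> sigma p <> p ->
  [/\ sigma p \in Irr T, rdown (sigma p) = p & up (sigma p)].
Proof. by case=> {}p // _ ->. Qed.

Lemma up_fixed_Irr p : up p -> sigma p = p -> p \in Irr T.
Proof. by case=> {}p // cI _ _ <-. Qed.

End IrreducibleElements.

(** * Moebius inversion and inclusion-exclusion on sets of pairs *)

Section Moebius.
Variables (k : fieldType) (I : finType).
Implicit Types D S W Z : {set I}.

Lemma sum_sign_subsets D :
  \sum_(S : {set I} | S \subset D) (-1) ^+ #|S| = (D == set0)%:R :> k.
Proof.
transitivity (\prod_(i : I) ((if i \in D then -1 else 0) + 1 : k)).
  rewrite bigA_distr big_mkcond /=; apply: eq_bigr => S _; case: (boolP (S \subset D)) => SD.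
    by rewrite -big_mkcond -prodr_const; apply: eq_bigr => i iS; rewrite (subsetP SD).
  have [i iS niD] := subsetPn SD.
  by rewrite (bigD1 i) //= iS (negbTE niD) mul0r.
have [->|/set0Pn[i iD]] := eqVneq D set0.
  by rewrite big1 // => i _; rewrite inE add0r.
by rewrite (bigD1 i) //= iD addNr mul0r.
Qed.

Definition moebius W S : k := if W \subset S then (-1) ^+ #|S :\: W| else 0.

Lemma sum_moebius W Z : \sum_S moebius W S * (S \subset Z)%:R = (W == Z)%:R.
Proof.
have [WZ|nWZ] := boolP (W \subset Z); last first.
  rewrite (_ : W == Z = false); last by apply: contraNF nWZ => /eqP->.
  rewrite big1 // => S _; rewrite /moebius; case: ifP => WS; rewrite ?mul0r //.
  by case: (boolP (S \subset Z)) nWZ => [/(subset_trans WS)->|]; rewrite ?mulr0.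
have -> : (W == Z) = (Z :\: W == set0) by rewrite setD_eq0 eqEsubset WZ.
rewrite -sum_sign_subsets.
transitivity (\sum_(S : {set I} | (W \subset S) && (S \subset Z)) (-1) ^+ #|S :\: W| : k).
  rewrite [RHS]big_mkcond; apply: eq_bigr => S _; rewrite /moebius.
  by case: (W \subset S); case: (S \subset Z); rewrite ?mulr1 ?mulr0 ?mul0r.
rewrite (reindex_onto (fun S : {set I} => S :|: W) (fun S => S :\: W)) /= => [|S /andP[WS _]]; last first.
  by apply/setP => i; rewrite !inE; case: (boolP (i \in W)) => [/(subsetP WS)->|]; rewrite ?orbF.
apply: eq_big => S.
  rewrite subsetUr subUset WZ andbT /= subsetD; congr (_ && _).
  by rewrite setDUl setDv setU0; apply/eqP/setDidPl.
by case/andP=> _ /eqP->.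
Qed.

End Moebius.

Section Covers.
Variables (k : fieldType) (E X : finType).
Implicit Types V P Q : {set E * X}.

Definition covers P Q V : bool :=
  (V \subset P) && [forall a, [exists x, ((a, x) \in V) && ((a, x) \in Q)]].

Lemma coversP P Q V :
  reflect ((forall a x, (a, x) \in V -> (a, x) \in P) /\
           (forall a, exists2 x, (a, x) \in V & (a, x) \in Q)) (covers P Q V).
Proof.
apply: (iffP andP) => -[H1 H2]; split.
- by move=> a x; apply: (subsetP H1).
- by move=> a; have /forallP/(_ a)/existsP[x /andP[]] := H2; exists x.
- by apply/subsetP => -[a x]; apply: H1.
- by apply/forallP => a; apply/existsP; have [x h1 h2] := H2 a; exists x; rewrite h1.
Qed.

Definition remove_rows P Q (S : {set E}) : {set E * X} :=
  P :\: [set p in Q | p.1 \in S].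

(** Inclusion-exclusion over the sets [S] of rows in which [V] misses [Q]. *)
Lemma covers_sum P Q V :
  (covers P Q V)%:R = \sum_(S : {set E}) (-1) ^+ #|S| * (V \subset remove_rows P Q S)%:R :> k.
Proof.
have [VP|nVP] := boolP (V \subset P); last first.
  rewrite /covers (negbTE nVP) big1 // => S _.
  rewrite (_ : V \subset _ = false) ?mulr0 //; apply: contraNF nVP => /subset_trans; apply.
  exact: subsetDl.
pose D := [set a | [forall x, ((a, x) \in V) ==> ((a, x) \notin Q)]].
have sub S : (V \subset remove_rows P Q S) = (S \subset D).
  rewrite subsetD VP disjoint_sym; apply/idP/subsetP => [dis a aS|SD].
    rewrite inE; apply/forallP => x; apply/implyP => axV; apply/negP => axQ.
    by have := disjointFr dis (_ : (a, x) \in _); rewrite inE axQ aS => /(_ isT); rewrite axV.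
  rewrite disjoint_subset; apply/subsetP => -[a x]; rewrite !inE /= => /andP[axQ /SD].
  by rewrite inE => /forallP/(_ x); rewrite axQ implybF.
under eq_bigr => S _ do rewrite sub.
have -> : covers P Q V = (D == set0).
  rewrite /covers VP /=; apply/forallP/eqP => [H|D0 a].
    apply/setP => a; rewrite !inE; apply/negbTE; have /existsP[x /andP[aV aQ]] := H a.
    by apply/forallPn; exists x; rewrite aV aQ.
  have : a \notin D by rewrite D0 inE.
  rewrite inE => /forallPn[x]; rewrite negb_imply negbK => aVQ; apply/existsP; by exists x.
rewrite -sum_sign_subsets big_mkcond; apply: eq_bigr => S _.
by case: ifP; rewrite ?mulr1 ?mulr0.
Qed.

Lemma moebius_covers W P Q :
  \sum_V moebius k W V * (covers P Q V)%:R =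
  \sum_(S : {set E}) (-1) ^+ #|S| * (W == remove_rows P Q S)%:R.
Proof.
under eq_bigr => V _ do rewrite covers_sum mulr_sumr.
rewrite exchange_big; apply: eq_bigr => S _ /=.
by rewrite -sum_moebius mulr_sumr; apply: eq_bigr => V _; rewrite mulrCA.
Qed.

End Covers.

(** * Spanning by maps into G *)

Section LatticeMaps.
Import Order.TTheory.
Variables (k : fieldType) (disp : Order.disp_t) (T : finTBLatticeType disp).
Variables (E X : finType) (f : E -> T).
Hypotheses (f_inj : injective f) (f_img : f @: setT = Irr T).
Implicit Types (t : T) (V : {set E * X}) (phi : {ffun X -> T}).

Lemma f_Irr a : f a \in Irr T.
Proof. by rewrite -f_img imset_f. Qed.

Lemma Irr_f t : t \in Irr T -> exists a, t = f a.
Proof. by rewrite -f_img => /imsetP[a _ ->]; exists a. Qed.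

(* The second component of a value (t, b) tells whether an irreducible t may
   witness its own row, as in a genuine map X -> T, or only bounds the columns. *)
Section MarkedMaps.
Implicit Type Phi : {ffun X -> T * bool}.

Definition lower_set Phi : {set E * X} := [set p | ((Phi p.2).1 <= f p.1)%O].
Definition mark_set Phi : {set E * X} := [set p | Phi p.2 == (f p.1, true)].
Definition marked_covers Phi V : bool := covers (lower_set Phi) (mark_set Phi) V.

Lemma marked_coversP Phi V :
  reflect ((forall a x, (a, x) \in V -> ((Phi x).1 <= f a)%O) /\
           (forall a, exists2 x, (a, x) \in V & Phi x = (f a, true)))
          (marked_covers Phi V).
Proof.
apply: (iffP (coversP _ _ _)) => -[H1 H2]; split.
- by move=> a x /H1; rewrite inE.
- by move=> a; have [x h1] := H2 a; rewrite inE => /eqP h2; exists x.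
- by move=> a x /H1; rewrite inE.
- by move=> a; have [x h1 h2] := H2 a; exists x => //; rewrite inE h2.
Qed.

(** The coheight is doubled so that a strict rise in [T] outweighs the loss of a mark. *)
Definition value_weight (v : T * bool) : nat := (coheight v.1 + coheight v.1 - v.2)%N.
Definition map_weight Phi : nat := (\sum_x value_weight (Phi x))%N.

Lemma coheight_gt0 t : (0 < coheight t)%N.
Proof. by apply/card_gt0P; exists t; rewrite inE lexx. Qed.

Lemma map_weight_lt Phi (g : T * bool -> T * bool) x :
  (forall v, value_weight (g v) <= value_weight v)%N ->
  (value_weight (g (Phi x)) < value_weight (Phi x))%N ->
  (map_weight [ffun y => g (Phi y)] < map_weight Phi)%N.
Proof.
move=> le lt; rewrite /map_weight [X in (_ < X)%N](bigD1 x) //= (bigD1 x) //= ffunE.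
by rewrite -addSn leq_add // leq_sum // => y _; rewrite ffunE.
Qed.

Lemma value_weight_lt s t b b' : (s < t)%O ->
  (value_weight (t, b) < value_weight (s, b'))%N.
Proof.
move=> /coheight_lt lt; rewrite /value_weight /=.
apply: leq_ltn_trans (leq_subr _ _) _; rewrite ltn_subRL.
apply: leq_ltn_trans (_ : 1 + (coheight t + coheight t) < _)%N.
  by rewrite leq_add2r leq_b1.
by rewrite add1n -addSn -addnS leq_add.
Qed.

Lemma value_weight_mark t : (value_weight (t, true) < value_weight (t, false))%N.
Proof. by rewrite /value_weight /= subn0 subn1 prednK // addn_gt0 coheight_gt0. Qed.

(** With every [b] marked, the row of [b] is witnessed either at a place already marked in [Phi],
    which is the case of [Phi], or only at new places. In the second case the entries at the old
    places lie strictly above [b], that is, above [s]. *)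
Lemma unmark_good Phi b s V : (b < s)%O ->
  (forall e, e \in Irr T -> (s <= e)%O = (b < e)%O) -> b \in Irr T ->
  (marked_covers Phi V)%:R =
  (marked_covers [ffun x => if Phi x == (b, false) then (b, true) else Phi x] V)%:R -
  (marked_covers [ffun x => if Phi x == (b, false) then (b, true) else
                            if Phi x == (b, true) then (s, false) else Phi x] V)%:R :> k.
Proof.
move=> lt_bs sE /Irr_f[c bE].
set Phi1 := finfun _; set Phi2 := [ffun x => if _ then _ else if _ then _ else _].
have Phi1_fst x : (Phi1 x).1 = (Phi x).1.
  by rewrite ffunE; case: eqP => [->|].
have not_both : marked_covers Phi V -> marked_covers Phi2 V = false.
  case/marked_coversP=> _ /(_ c)[x cx Phix]; apply/negP => /marked_coversP[/(_ _ _ cx)].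
  by rewrite ffunE Phix -bE !xpair_eqE eqxx /= lt_geF.
have cov01 : marked_covers Phi V -> marked_covers Phi1 V.
  case/marked_coversP=> H1 H2; apply/marked_coversP; split=> [a x|a].
    by rewrite Phi1_fst; apply: H1.
  by have [x ax Phix] := H2 a; exists x; rewrite // ffunE Phix xpair_eqE andbF.
have cov21 : marked_covers Phi2 V -> marked_covers Phi1 V.
  case/marked_coversP=> H1 H2; apply/marked_coversP; split=> [a x /H1|a].
    rewrite Phi1_fst ffunE; case: eqP => [->|_] //; case: eqP => [->|_] //=.
    by apply: le_trans; apply: ltW.
  have [x ax] := H2 a; rewrite ffunE => Phi2x; exists x => //; rewrite ffunE.
  by move: Phi2x; case: eqP => // _; case: eqP.
have cov1 : marked_covers Phi1 V -> marked_covers Phi V \/ marked_covers Phi2 V.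
  case/marked_coversP=> H1 H2.
  have [/existsP[x0 /andP[cx0 /eqP Phix0]]|none] :=
      boolP [exists x, ((c, x) \in V) && (Phi x == (b, true))].
    left; apply/marked_coversP; split=> [a x /H1|a]; first by rewrite Phi1_fst.
    have [x ax] := H2 a; rewrite ffunE; case: eqP => [Phix|_]; last by exists x.
    by case=> ba; exists x0; rewrite -?ba //; move: cx0; rewrite (f_inj (etrans (esym bE) ba)).
  have noneE x a : (a, x) \in V -> Phi x = (b, true) -> b <> f a.
    move=> ax Phix ba; case/negP: none; apply/existsP; exists x.
    by rewrite (f_inj (etrans (esym bE) ba)) ax Phix eqxx.
  right; apply/marked_coversP; split=> [a x ax|a].
    have := H1 _ _ ax; rewrite Phi1_fst ffunE; case: eqP => [->|_] //.
    case: eqP => [Phix|_] //; rewrite Phix /= => le_ba.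
    by rewrite sE ?f_Irr // lt_neqAle le_ba andbT; apply/eqP/(noneE x).
  have [x ax Phi1x] := H2 a; exists x => //; move: Phi1x; rewrite !ffunE.
  case: eqP => // _ Phix; case: eqP => // Phixb.
  by case: (noneE x a ax Phixb); move: Phix; rewrite Phixb => -[].
case: (boolP (marked_covers Phi V)) cov01 not_both cov1 => [_ /(_ isT)-> /(_ isT)-> _|_ _ _ cov1].
  by rewrite subr0.
case: (boolP (marked_covers Phi2 V)) cov21 cov1 => [_ /(_ isT)-> _|_ _ cov1].
  by rewrite subrr.
by case: (boolP (marked_covers Phi1 V)) cov1 => [_ /(_ isT)[]|_ _] //; rewrite subrr.
Qed.

(** A reducible value matters only through the irreducibles above it, and its mark witnesses no
    row. *)
Lemma reducible_covers Phi t b s b' V : t \notin Irr T ->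
  (s \notin Irr T) || ~~ b' -> (forall e, e \in Irr T -> (s <= e)%O = (t <= e)%O) ->
  marked_covers Phi V = marked_covers [ffun x => if Phi x == (t, b) then (s, b') else Phi x] V.
Proof.
move=> nI nIs sE; set Phi' := finfun _.
have lowE a x : ((Phi x).1 <= f a)%O = ((Phi' x).1 <= f a)%O.
  by rewrite ffunE; case: eqP => [->|//]; rewrite /= sE ?f_Irr.
have markE a x : Phi x = (f a, true) <-> Phi' x = (f a, true).
  rewrite ffunE; case: eqP => [->|//]; split=> -[tE bE].
    by move: nI; rewrite tE f_Irr.
  by move: nIs; rewrite tE bE f_Irr.
apply/marked_coversP/marked_coversP => -[H1 H2]; split=> [a x ax|a].
- by rewrite -lowE; apply: H1.
- by have [x ax /markE] := H2 a; exists x.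
- by rewrite lowE; apply: H1.
- by have [x ax /markE] := H2 a; exists x.
Qed.

End MarkedMaps.

Definition mark_all phi : {ffun X -> T * bool} := [ffun x => (phi x, true)].

Definition G_maps : {set {ffun X -> T}} :=
  [set phi : {ffun X -> T} | [forall x, phi x \in G_set T] && [forall a, [exists x, phi x == f a]]].

Lemma G_mapsP phi : reflect ((forall x, phi x \in G_set T) /\ (forall a, exists x, phi x = f a))
                            (phi \in G_maps).
Proof.
rewrite inE; apply: (iffP andP) => -[H1 H2]; split.
- exact/forallP.
- by move=> a; have /forallP/(_ a)/existsP[x /eqP] := H2; exists x.
- exact/forallP.
- by apply/forallP => a; apply/existsP; have [x /eqP] := H2 a; exists x.
Qed.

Definition in_G_span (F : {set E * X} -> k) : Prop := exists c : {ffun X -> T} -> k,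
  forall V, F V = \sum_(phi in G_maps) c phi * (marked_covers (mark_all phi) V)%:R.

Lemma in_G_span_sub F F' : in_G_span F -> in_G_span F' -> in_G_span (fun V => F V - F' V).
Proof.
move=> [c Hc] [c' Hc']; exists (fun phi => c phi - c' phi) => V.
by rewrite Hc Hc' -sumrB; apply: eq_bigr => phi _; rewrite mulrBl.
Qed.

Lemma eq_in_G_span F F' : F =1 F' -> in_G_span F' -> in_G_span F.
Proof. by move=> FF' [c Hc]; exists c => V; rewrite FF'. Qed.

(** The invariant of the elimination: an unmarked irreducible value is [good], so that [unmark_good]
    can remove it. *)
Definition admissible (v : T * bool) := [\/ v.2 = true, v.1 \notin Irr T | good v.1].

(** Induction on [map_weight]. Unmarked values go first: reducible ones are marked, irreducible ones
    removed by [unmark_good]. Then a value outside [G_set] is reducible and [good], and is raised to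
    the next [s]. *)
Lemma marked_covers_span (Phi : {ffun X -> T * bool}) :
  (forall x, admissible (Phi x)) -> in_G_span (fun V => (marked_covers Phi V)%:R).
Proof.
have [n le_n] := ubnP (map_weight Phi); elim: n Phi le_n => // n IHn Phi le_n adm.
have IH (g : T * bool -> T * bool) x : (forall v, admissible v -> admissible (g v)) ->
    (forall v, value_weight (g v) <= value_weight v)%N ->
    (value_weight (g (Phi x)) < value_weight (Phi x))%N ->
    in_G_span (fun V => (marked_covers [ffun y => g (Phi y)] V)%:R).
  move=> adm_g le lt; apply: IHn => [|y]; last by rewrite ffunE; apply: adm_g.
  by rewrite -ltnS (leq_trans _ le_n) // ltnS; apply: map_weight_lt lt.
have raise (t : T) b s b' x : Phi x = (t, b) -> admissible (s, b') -> t \notin Irr T ->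
    (s \notin Irr T) || ~~ b' -> (forall e, e \in Irr T -> (s <= e)%O = (t <= e)%O) ->
    (value_weight (s, b') < value_weight (t, b))%N ->
    in_G_span (fun V => (marked_covers Phi V)%:R).
  move=> Phix adm_s nI nIs sE lt.
  apply: (eq_in_G_span (F' := fun V => (marked_covers
    [ffun x => if Phi x == (t, b) then (s, b') else Phi x] V)%:R)).
    by move=> V; rewrite (reducible_covers _ b _ nI nIs sE).
  apply: (IH (fun v => if v == (t, b) then (s, b') else v) x) => [v|v|].
  - by case: eqP.
  - by case: eqP => [->|//]; apply: ltnW.
  - by rewrite Phix eqxx.
have [[x Phix2]|marked] := classic (exists x, (Phi x).2 = false).
  case Phix: (Phi x) Phix2 => [b m] /= m0; rewrite {}m0 in Phix.
  have [bI|nI] := boolP (b \in Irr T); last first.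
    by apply: (raise b false b true x) => //; rewrite ?nI ?value_weight_mark //; constructor 1.
  have good_b : good b by case: (adm x); rewrite Phix //= bI.
  have [s [lt_bs sE adm_s]] : exists s, [/\ (b < s)%O,
      forall e, e \in Irr T -> (s <= e)%O = (b < e)%O & admissible (s, false)].
    by case: good_b => p s lt sE ?; exists s; split=> //; [constructor 2 | constructor 3].
  apply: eq_in_G_span (fun V => unmark_good Phi V lt_bs sE bI) _; apply: in_G_span_sub.
    apply: (IH (fun v => if v == (b, false) then (b, true) else v) x) => [v|v|].
    - by case: eqP => // _ _; constructor 1.
    - by case: eqP => [->|//]; apply/ltnW/value_weight_mark.
    - by rewrite Phix eqxx value_weight_mark.
  apply: (IH (fun v => if v == (b, false) then (b, true) else
                       if v == (b, true) then (s, false) else v) x) => [v|v|].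
  - by case: eqP => [_ _|_]; [constructor 1 | case: eqP].
  - case: eqP => [->|_]; first exact/ltnW/value_weight_mark.
    by case: eqP => [->|//]; apply/ltnW/value_weight_lt.
  - by rewrite Phix eqxx value_weight_mark.
have {}marked x : Phi x = ((Phi x).1, true).
  by case: (Phi x) (fun h => marked (ex_intro _ x h)) => t [] //= [].
have [[x nG]|inG] := classic (exists x, (Phi x).1 \notin G_set T).
  set t := (Phi x).1 in nG; have [nL nup] : t \notin Lambda_Irr T /\ ~ (t \notin Irr T /\ up t).
    by split; [apply: contra nG => tL | move=> H; case/negP: nG]; apply/G_setP; [left | right].
  have nI : t \notin Irr T by apply: contra nL; apply: Irr_Lambda.
  have good_t : good t.
    case: (sigma_up_good t) => // [fix_t|up_t]; last by case: nup.
    by move: nL; rewrite Lambda_reducible // fix_t eqxx.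
  have [s [lt_ts sE adm_s]] : exists s, [/\ (t < s)%O,
      forall e, e \in Irr T -> (s <= e)%O = (t < e)%O & admissible (s, false)].
    by case: good_t => p s lt sE ?; exists s; split=> //; [constructor 2 | constructor 3].
  apply: (raise t true s false x) => //; rewrite ?orbT //; last exact: value_weight_lt.
  by move=> e eI; rewrite sE // lt_Irr_reducible.
pose phi : {ffun X -> T} := [ffun x => (Phi x).1].
have PhiE : Phi = mark_all phi by apply/ffunP => x; rewrite !ffunE marked.
have [phiG|nphi] := boolP (phi \in G_maps).
  exists (fun psi => (psi == phi)%:R) => V; rewrite (bigD1 phi) //= eqxx mul1r -PhiE.
  by rewrite big1 ?addr0 // => psi /andP[_ /negbTE->]; rewrite mul0r.
(* All values lie in [G_set], so some row has no witness and the function is zero. *)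
exists (fun=> 0) => V; rewrite big1 => [|psi _]; last by rewrite mul0r.
rewrite (_ : marked_covers _ _ = false) //; apply/negP => /marked_coversP[_ H].
case/negP: nphi; apply/G_mapsP; split=> [x|a].
  by rewrite ffunE; apply/negPn/negP => nG; apply: inG; exists x.
by have [x _ Phix] := H a; exists x; rewrite ffunE Phix.
Qed.

End LatticeMaps.

(** * Independence of maps into G *)

Section LeadingTerms.
Import Order.TTheory.
Local Open Scope order_scope.
Variables (disp : Order.disp_t) (T : finTBLatticeType disp).
Implicit Types (s t e : T).

Definition is_up t : bool :=
  if excluded_middle_informative (up t) then true else false.

Lemma upP t : reflect (up t) (is_up t).
Proof. by rewrite /is_up; case: excluded_middle_informative => H; constructor. Qed.

(* Maps phi, psi : X -> G are compared through the relations {(x, e) | phi x <= e}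
   with the graph of phi removed on the irreducible [up] elements only. *)
Definition below t e : bool := if is_up t then t < e else t <= e.

Lemma G_not_up t : t \in G_set T -> ~~ is_up t -> t \in Lambda_Irr T.
Proof.
by move=> /G_setP[//|[_ up_t]] /upP.
Qed.

(** An element of [G_set] that is not [up] is the meet of the irreducibles above it; an [up] element
    is recovered from its [sigma], as that element itself or its [rdown]. *)
Lemma below_inj : {in G_set T &, forall s t,
  (forall e, e \in Irr T -> below s e = below t e) -> s = t}.
Proof.
(* Here [sigma s = t]; were [s] different from [t], the chain of [s] would continue through [t] and
   make it [up]. *)
have mixed s t : t \in G_set T -> is_up s -> ~~ is_up t ->
    (forall e, e \in Irr T -> (s < e) = (t <= e)) -> s = t.
  move=> tG cs nct H; have sE : sigma s = t.
    apply/eqP; rewrite eq_le; apply/andP; split.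
      have /Lambda_IrrP := G_not_up tG nct; apply=> e eI te.
      by apply: sigma_le; rewrite ?H.
    by apply/le_sigmaP => e eI; rewrite H.
  have [fix_s|/eqP nfix] := eqVneq (sigma s) s; first by rewrite -sE.
  have [_ _ /upP] := up_sigma (upP s cs) nfix.
  by rewrite sE (negbTE nct).
have fixed s t : is_up s -> is_up t ->
    (forall e, e \in Irr T -> (s < e) = (t < e)) -> sigma s = s -> s = t.
  move=> cs ct H fix_s; have sE : sigma t = s.
    rewrite -fix_s; apply/eqP; rewrite eq_le; apply/andP; split; apply/le_sigmaP => e eI.
      by rewrite H //; apply: sigma_le.
    by rewrite -H //; apply: sigma_le.
  have [<-//|/eqP nfix] := eqVneq (sigma t) t.
  have sI : s \in Irr T by apply: up_fixed_Irr (upP _ cs) fix_s.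
  have := H s sI; rewrite ltxx -sE lt_neqAle eq_sym sigma_ge andbT.
  by move/eqP: nfix => ->.
move=> s t sG tG; rewrite /below.
case: (boolP (is_up s)) => cs; case: (boolP (is_up t)) => ct H.
- have [fix_s|/eqP ns] := eqVneq (sigma s) s; first exact: fixed.
  have [fix_t|/eqP nt] := eqVneq (sigma t) t.
    by apply/esym/fixed => // e eI; rewrite H.
  have [_ <- _] := up_sigma (upP _ cs) ns.
  have [_ <- _] := up_sigma (upP _ ct) nt.
  congr (rdown _); apply/eqP; rewrite eq_le; apply/andP; split; apply/le_sigmaP => e eI.
    by rewrite -H //; apply: sigma_le.
  by rewrite H //; apply: sigma_le.
- exact: mixed.
- by apply/esym/mixed => // e eI; rewrite H.
- apply/eqP; rewrite eq_le; apply/andP; split.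
    by have /Lambda_IrrP := G_not_up tG ct; apply=> e eI; rewrite -H.
  by have /Lambda_IrrP := G_not_up sG cs; apply=> e eI; rewrite H.
Qed.

(** The [up] elements weigh more than all others and get lighter with height; the others get
    heavier. *)
Definition chain_weight t : nat :=
  if is_up t then (#|T|.+1 + (#|T| - height t))%N else height t.

Lemma height_le t : (height t <= #|T|)%N.
Proof. exact: max_card. Qed.

(** The flag [b] says whether the row of [t] is removed. If [t] is reducible or [b] agrees with
    [is_up t], the right side is [below t] and [below_inj] applies; each kind of mismatch gives a
    comparison of weights or equality. *)
Lemma below_triangular s t (b : bool) : s \in G_set T -> t \in G_set T ->
  (forall e, e \in Irr T -> below s e = (t <= e) && ~~ (b && (t == e))) ->
  s = t \/ (chain_weight t < chain_weight s)%N.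
Proof.
move=> sG tG H; have [same|] := boolP ((t \notin Irr T) || (b == is_up t)).
  left; apply: below_inj => // e eI; rewrite H // /below.
  case/orP: same => [nI|/eqP->].
    rewrite (_ : t == e = false) ?andbF ?andbT.
      by case: ifP; rewrite // lt_Irr_reducible.
    by apply: contraNF nI => /eqP->.
  by case: (is_up t); rewrite ?andbT // andbC lt_neqAle.
rewrite negb_or negbK => /andP[tI]; rewrite /chain_weight; move: H.
case: b => /= H.
  have {}H e : e \in Irr T -> below s e = (t < e).
    by move=> eI; rewrite H // andbC -lt_neqAle.
  rewrite eq_sym eqb_id => /negbTE nct; rewrite nct.
  case: ifP => cs; first by right; rewrite ltnS (leq_trans (height_le t)) ?leq_addr.
  have le_ts : t <= s.
    have /Lambda_IrrP := G_not_up sG (negbT cs); apply=> e eI se.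
    by rewrite ltW // -H // /below cs.
  have [->|nts] := eqVneq t s; [by left | right].
  by apply: height_lt; rewrite lt_neqAle nts.
have {}H e : e \in Irr T -> below s e = (t <= e) by move=> eI; rewrite H // andbT.
rewrite eq_sym eqbF_neg negbK => ct; rewrite ct.
have := H t tI; rewrite lexx /below; case: ifP => cs lt_st.
  right; rewrite ltn_add2l ltn_sub2l ?height_lt //.
  by apply: leq_trans (height_le t); apply: height_lt.
left; apply/eqP; rewrite eq_le lt_st /=.
have /Lambda_IrrP := G_not_up sG (negbT cs); apply=> e eI se.
by rewrite -H // /below cs.
Qed.

End LeadingTerms.

Section DualFamily.
Import Order.TTheory.
Variables (k : fieldType) (disp : Order.disp_t) (T : finTBLatticeType disp).
Variables (E X : finType) (f : E -> T).
Hypotheses (f_inj : injective f) (f_img : f @: setT = Irr T).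

Definition leading_relation (phi : {ffun X -> T}) : {set E * X} :=
  [set p | below (phi p.2) (f p.1)].

Lemma remove_mark_allP (phi : {ffun X -> T}) S a x :
  ((a, x) \in remove_rows (lower_set f (mark_all phi)) (mark_set f (mark_all phi)) S) =
  (phi x <= f a)%O && ~~ ((a \in S) && (phi x == f a)).
Proof. by rewrite !inE /= !ffunE /= xpair_eqE andbT andbC [X in ~~ X]andbC. Qed.

Lemma up_rows_leading (phi : {ffun X -> T}) :
  leading_relation phi = remove_rows (lower_set f (mark_all phi)) (mark_set f (mark_all phi))
    [set a | is_up (f a)].
Proof.
apply/setP => -[a x]; rewrite remove_mark_allP !inE /= /below.
have [->|ne] := eqVneq (phi x) (f a); last first.
  by rewrite andbF andbT; case: ifP; rewrite // lt_neqAle ne.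
by rewrite andbT lexx ltxx; case: is_up.
Qed.

Definition leading_coef (phi psi : {ffun X -> T}) : k :=
  \sum_V moebius k (leading_relation phi) V * (marked_covers f (mark_all psi) V)%:R.

(** As [phi] hits every irreducible, distinct sets of removed rows give distinct relations, so one
    term of [moebius_covers] survives. *)
Lemma leading_coef_diag phi : phi \in G_maps X f -> leading_coef phi phi != 0.
Proof.
case/G_mapsP => _ onto; rewrite /leading_coef moebius_covers up_rows_leading.
rewrite (bigD1 [set a | is_up (f a)]) //= eqxx mulr1 big1 ?addr0 => [|S nS].
  by rewrite signr_eq0.
rewrite (_ : _ == _ = false) ?mulr0 //; apply: contraNF nS => /eqP eq_rem.
apply/eqP/setP => a; have [x phix] := onto a.
have /setP/(_ (a, x)) := eq_rem; rewrite !remove_mark_allP phix lexx eqxx !andbT /=.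
by move/negb_inj.
Qed.

(** A nonzero coefficient means that removing rows from [psi] yields the leading relation of [phi];
    [below_triangular] compares the two maps at each [x]. *)
Lemma leading_coef_triangular : {in G_maps X f &, forall phi psi, leading_coef phi psi != 0 ->
  phi = psi \/ (\sum_x chain_weight (psi x) < \sum_x chain_weight (phi x))%N}.
Proof.
move=> phi psi /G_mapsP[phiG _] /G_mapsP[psiG _] nz.
have [S eqS] : exists S, leading_relation phi =
    remove_rows (lower_set f (mark_all psi)) (mark_set f (mark_all psi)) S.
  apply: NNPP => none; move: nz; rewrite /leading_coef moebius_covers big1 ?eqxx // => S _.
  by rewrite (_ : _ == _ = false) ?mulr0 //; apply/eqP => eqS; apply: none; exists S.
have col x : phi x = psi x \/ (chain_weight (psi x) < chain_weight (phi x))%N.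
  have inS e : e \in Irr T -> below (phi x) e =
      (psi x <= e)%O && ~~ ([exists a in S, psi x == f a] && (psi x == e)).
    case/(Irr_f f_img) => a ->; have /setP/(_ (a, x)) := eqS.
    rewrite remove_mark_allP inE /= => ->; congr (_ && ~~ _).
    case: eqP => [E0|]; rewrite ?andbF ?andbT //.
    apply/idP/existsP => [aS|[b /andP[bS /eqP]]]; first by exists a; rewrite aS E0 eqxx.
    by rewrite E0 => /f_inj ->.
  exact: below_triangular inS.
have le x : (chain_weight (psi x) <= chain_weight (phi x))%N.
  by case: (col x) => [->|/ltnW].
have [->|/eqP/ffunP ne] := eqVneq phi psi; [by left | right].
have [x nx] : exists x, phi x <> psi x by apply: not_all_ex_not.
rewrite (bigD1 x) //= [X in (_ < X)%N](bigD1 x) //= -addSn leq_add ?leq_sum //.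
by case: (col x).
Qed.

Lemma G_maps_dual_family : exists D : {ffun X -> T} -> {set E * X} -> k,
  {in G_maps X f &, forall phi psi,
    \sum_V D phi V * (marked_covers f (mark_all psi) V)%:R = (phi == psi)%:R}.
Proof.
have [D HD] := triangular_dual_family leading_coef_diag leading_coef_triangular.
exists (fun phi V => \sum_(psi in G_maps X f) D phi psi * moebius k (leading_relation psi) V).
move=> phi psi phiG psiG; rewrite -HD //.
under eq_bigr => V _ do rewrite mulr_suml.
rewrite exchange_big; apply: eq_bigr => l _; rewrite mulr_sumr.
by apply: eq_bigr => V _; rewrite mulrA.
Qed.

End DualFamily.

(** * Action of the automorphisms *)

Section Transport.
Import Order.TTheory.
Local Open Scope order_scope.
Variables (disp : Order.disp_t) (T : finTBLatticeType disp).
Variables (E : finType) (f : E -> T) (R : {set E * E}).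
Hypotheses (f_inj : injective f) (f_img : f @: setT = Irr T).
Hypothesis f_R : forall x y, ((x, y) \in R) = (f x <= f y).
Implicit Types (t u : T).

Lemma le_f t u : (forall c, f c <= t -> f c <= u) -> t <= u.
Proof. by move=> H; apply: le_Irr => e /(Irr_f f_img)[c ->]; apply: H. Qed.

Lemma eq_f t u : (forall c, (f c <= t) = (f c <= u)) -> t = u.
Proof.
by move=> H; apply/eqP; rewrite eq_le; apply/andP; split; apply: le_f => c; rewrite H.
Qed.

Variable s : {perm E}.
Hypothesis s_aut : s \in poset_aut R.

Lemma le_f_aut a b : (f (s a) <= f (s b)) = (f a <= f b).
Proof. by rewrite -!f_R; have /poset_autP := s_aut. Qed.

(* s need not act on T; [transported t t'] says that t' is the image of t under
   the inverse of s, identifying an element with the irreducibles below it. *)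
Definition transported t t' := forall c, (f c <= t') = (f (s c) <= t).

Lemma transported_le t t' u u' : transported t t' -> transported u u' ->
  (t' <= u') = (t <= u).
Proof.
move=> tt' uu'; apply/idP/idP => H; apply: le_f => c; last first.
  by rewrite tt' uu' => /le_trans; apply.
by rewrite -(permKV s c) -tt' -uu' => /le_trans; apply.
Qed.

Lemma transported_lt t t' u u' : transported t t' -> transported u u' ->
  (t' < u') = (t < u).
Proof.
by move=> tt' uu'; rewrite !lt_leAnge (transported_le tt' uu') (transported_le uu' tt').
Qed.

Lemma transported_fun t t1 t2 : transported t t1 -> transported t t2 -> t1 = t2.
Proof. by move=> h1 h2; apply: eq_f => c; rewrite h1 h2. Qed.

Lemma transported_f a : transported (f (s a)) (f a).
Proof. by move=> c; rewrite le_f_aut. Qed.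

Lemma transported_Irr t t' : transported t t' -> (t' \in Irr T) = (t \in Irr T).
Proof.
move=> tt'; apply/idP/idP => /(Irr_f f_img)[a E0].
  have -> : t = f (s a).
    by apply: eq_f => c; rewrite -(permKV s c) -tt' E0 -transported_f.
  exact: f_Irr f_img _.
have -> : t' = f (s^-1%g a).
  by apply: (transported_fun tt'); rewrite E0 -{1}(permKV s a); apply: transported_f.
exact: f_Irr f_img _.
Qed.

Lemma transported_sigma t t' : transported t t' -> transported (sigma t) (sigma t').
Proof.
move=> tt' c; apply/le_sigmaP/le_sigmaP => H e /(Irr_f f_img)[b ->].
  rewrite -(permKV s b) -(transported_lt tt' (transported_f _)) => lt.
  by rewrite le_f_aut; apply: H => //; apply: f_Irr f_img _.
rewrite (transported_lt tt' (transported_f _)) => lt.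
by rewrite -le_f_aut; apply: H => //; apply: f_Irr f_img _.
Qed.

Lemma le_rdown_Irr t u : t \in Irr T -> (u <= rdown t) = (u < t).
Proof.
by move=> tI; apply/idP/idP => [H|/le_rdown //]; apply: le_lt_trans H (rdown_lt tI).
Qed.

Lemma transported_rdown t t' : t \in Irr T -> transported t t' ->
  transported (rdown t) (rdown t').
Proof.
move=> tI tt' c; rewrite !le_rdown_Irr ?(transported_Irr tt') //.
by rewrite (transported_lt (transported_f _) tt').
Qed.

Lemma transported_up t : up t -> exists2 t', transported t t' & up t'.
Proof.
elim=> {t} [t tI fix_t|t cI rt _ [q tq up_q]].
  have [a tE] := Irr_f f_img tI; have tr := transported_f (s^-1%g a).
  rewrite permKV -tE in tr; exists (f (s^-1%g a)) => //.
  apply: up_fixed; first exact: f_Irr f_img _.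
  by apply: (transported_fun _ tr); rewrite -{1}fix_t; apply: transported_sigma.
have tr := transported_rdown cI tq; rewrite rt in tr; exists (rdown q) => //.
have sE : sigma (rdown q) = q by apply: transported_fun (transported_sigma tr) tq.
by apply: up_step; rewrite sE // (transported_Irr tq).
Qed.

Lemma transported_G_set t : t \in G_set T -> exists2 t', transported t t' & t' \in G_set T.
Proof.
case/G_setP => [/Lambda_IrrP tL|[nI /transported_up[t' tt' up_t']]]; last first.
  by exists t' => //; apply/G_setP; right; rewrite (transported_Irr tt').
(* As [t] is the meet of the irreducibles above it, its image is the meet of their preimages under
   [s]. *)
exists (\meet_(a | t <= f (s a)) f a) => [c|].
  apply/meetsP/idP => [H|le_ct a ta]; last by rewrite -le_f_aut; apply: le_trans le_ct ta.
  apply: tL => e /(Irr_f f_img)[a ->] ta.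
  by rewrite -(permKV s a) le_f_aut; apply: H; rewrite permKV.
apply/G_setP; left; apply/Lambda_IrrP => u Hu; apply/meetsP => a ta.
by apply: Hu; [apply: f_Irr f_img _ | apply: (meets_inf f)].
Qed.

End Transport.

(** * The column basis given by maps into G *)

Section LatticeColumnBasis.
Import Order.TTheory.
Variables (k : fieldType) (disp : Order.disp_t) (T : finTBLatticeType disp).
Variables (X E : finType) (f : E -> T) (R : {set E * E}).
Hypotheses (f_inj : injective f) (f_img : f @: setT = Irr T).
Hypothesis f_R : forall x y, ((x, y) \in R) = (f x <= f y)%O.

Definition rel_of (phi : {ffun X -> T}) : {set X * E} := [set p | (f p.2 <= phi p.1)%O].

Definition map_of (U : {set X * E}) : {ffun X -> T} :=
  [ffun x => (\join_(c | (x, c) \in U) f c)%O].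

Lemma rel_ofK : cancel rel_of map_of.
Proof.
move=> phi; apply/ffunP => x; rewrite ffunE; apply/eqP; rewrite eq_le; apply/andP; split.
  by apply/joinsP => c; rewrite inE.
by apply: (le_f f_img) => c cx; apply: (joins_sup f); rewrite inE.
Qed.

Lemma between_map_of V U :
  between R (rcomp V U) = marked_covers f (mark_all (map_of U)) V.
Proof.
have le_map x c : (x, c) \in U -> (f c <= map_of U x)%O.
  by move=> xc; rewrite ffunE; apply: (joins_sup f).
apply/betweenP/marked_coversP => -[H1 H2]; split.
- move=> a x ax; rewrite !ffunE; apply/joinsP => c xc; rewrite -f_R.
  by apply: H2; apply/rcompP; exists x.
- move=> a; have /rcompP[x ax xa] := H1 a; exists x => //; rewrite ffunE; congr (_, _).
  apply/eqP; rewrite eq_le le_map // andbT ffunE; apply/joinsP => c xc; rewrite -f_R.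
  by apply: H2; apply/rcompP; exists x.
- move=> a; have [x ax] := H2 a; rewrite !ffunE => -[faE]; apply/rcompP; exists x => //.
  (* The irreducible [f a] is the join of the [f c] with [c] in [U_x], hence is one of them. *)
  suff /imsetP[c xc /f_inj->] : f a \in f @: [set c | (x, c) \in U] by rewrite inE in xc.
  have /IrrP := f_Irr f_img a; apply.
  rewrite big_imset /=; last by move=> c c' _ _; apply: f_inj.
  by rewrite -faE; apply: eq_bigl => c; rewrite inE.
- move=> a b /rcompP[x ax xb]; rewrite f_R; apply: le_trans (le_map _ _ xb) _.
  by have := H1 _ _ ax; rewrite ffunE.
Qed.

Definition lattice_basis : {set {set X * E}} := rel_of @: G_maps X f.

Lemma lattice_basis_stable s U :
  s \in poset_aut R -> U \in lattice_basis -> rperm s U \in lattice_basis.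
Proof.
move=> sA /imsetP[phi /G_mapsP[phiG onto] ->].
have ex x : exists t, transported f s (phi x) t /\ t \in G_set T.
  by have [t] := transported_G_set f_img f_R sA (phiG x); exists t.
have [psi Hpsi] := fin_all_exists ex.
apply/imsetP; exists [ffun x => psi x].
  apply/G_mapsP; split=> [x|a]; first by rewrite ffunE; case: (Hpsi x).
  have [x phix] := onto (s a); exists x; rewrite ffunE; have [tr _] := Hpsi x.
  rewrite phix in tr; apply: (transported_fun f_img tr); exact: (transported_f f_R sA).
apply/setP => -[x c]; rewrite mem_rperm !inE /= ffunE.
by have [-> _] := Hpsi x.
Qed.

Lemma lattice_column_basis : exists d : {set X * E} -> {set E * X} -> k,
  column_basis R lattice_basis d.
Proof.
have [D HD] := G_maps_dual_family k X f_inj f_img.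
exists (fun U V => D (map_of U) V); split.
- exact: lattice_basis_stable.
- move=> _ _ /imsetP[phi phiG ->] /imsetP[psi psiG ->].
  rewrite (inj_eq (can_inj rel_ofK)) rel_ofK -HD //; apply: eq_bigr => V _.
  by rewrite /between_coef between_map_of rel_ofK.
- move=> V U; have [|c Hc] := @marked_covers_span k _ _ _ _ f f_inj f_img (mark_all (map_of U)).
    by move=> x; rewrite ffunE; constructor 1.
  rewrite /between_coef between_map_of Hc big_imset /=; last first.
    by move=> phi psi _ _; apply: (can_inj rel_ofK).
  (* The coefficient [c phi] is recovered by pairing the expansion with the dual vector of [phi]. *)
  apply: eq_bigr => phi phiG; rewrite between_map_of rel_ofK; congr (_ * _).
  under eq_bigr => V' _ do rewrite between_map_of Hc mulr_sumr.
  rewrite exchange_big (bigD1 phi) //=.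
  under eq_bigr => V' _ do rewrite mulrCA.
  rewrite -mulr_sumr HD // eqxx mulr1 big1 ?addr0 // => psi /andP[psiG /negbTE ne].
  under eq_bigr => V' _ do rewrite mulrCA.
  by rewrite -mulr_sumr HD // eq_sym ne mulr0.
Qed.

Lemma card_lattice_basis : #|lattice_basis| = #|G_maps X f|.
Proof. exact/card_imset/(can_inj rel_ofK). Qed.

End LatticeColumnBasis.

(** * Counting maps into G and the dimension formula *)

Lemma sum_over_card (V : zmodType) (n : nat) (F : nat -> V) :
  \sum_(S : {set 'I_n}) F #|S| = \sum_(i < n.+1) F i *+ 'C(n, i).
Proof.
have bound (S : {set 'I_n}) : (#|S| < n.+1)%N by rewrite ltnS -[X in (_ <= X)%N]card_ord max_card.
rewrite (partition_big (fun S : {set 'I_n} => inord #|S| : 'I_n.+1) predT) //=.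
apply: eq_bigr => i _; rewrite -[X in 'C(X, _)]card_ord -card_draws -sumr_const.
apply: eq_big => [S|S /eqP <-]; last by rewrite inordK.
by rewrite inE -val_eqE /= inordK.
Qed.

(** Inclusion-exclusion over the sets [S] of missed points: [f @: S] is a subset of [G_set T] with
    [#|S|] elements. *)
Lemma card_G_maps (disp : Order.disp_t) (T : finTBLatticeType disp) (X : finType)
    (n : nat) (f : 'I_n -> T) : injective f -> f @: setT = Irr T ->
  #|G_maps X f|%:R = \sum_(i < n.+1) (-1) ^+ i * 'C(n, i)%:R *
    (#|G_set T|%:R - i%:R) ^+ #|X| :> rat.
Proof.
move=> f_inj f_img.
pose F i : rat := (-1) ^+ i * (#|G_set T|%:R - i%:R) ^+ #|X|.
transitivity (\sum_(S : {set 'I_n}) F #|S|); last first.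
  by rewrite sum_over_card; apply: eq_bigr => i _; rewrite -[LHS]mulr_natr /F mulrAC.
pose missing (phi : {ffun X -> T}) := [set a | [forall x, phi x != f a]].
transitivity (\sum_(phi : {ffun X -> T} | phi \in ffun_on (G_set T))
    \sum_(S : {set 'I_n} | S \subset missing phi) (-1) ^+ #|S| : rat).
  rewrite -sum1_card natr_sum [RHS]big_mkcond [LHS]big_mkcond; apply: eq_bigr => phi _ /=.
  rewrite sum_sign_subsets.
  have -> : (missing phi == set0) = [forall a, [exists x, phi x == f a]].
    apply/eqP/forallP => [m0 a|H].
      have : a \notin missing phi by rewrite m0 inE.
      by rewrite inE negb_forall => /existsP[x]; rewrite negbK => Hx; apply/existsP; exists x.
    apply/setP => a; rewrite !inE; apply/negbTE; rewrite negb_forall.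
    by have /existsP[x Hx] := H a; apply/existsP; exists x; rewrite negbK.
  rewrite inE (_ : (phi \in ffun_on _) = [forall x, phi x \in G_set T]) //.
  by case: [forall x, phi x \in G_set T] => //=; case: ([forall a, _]).
transitivity (\sum_(phi : {ffun X -> T} | phi \in ffun_on (G_set T))
    \sum_(S : {set 'I_n}) if S \subset missing phi then (-1) ^+ #|S| else 0 : rat).
  by apply: eq_bigr => phi _; rewrite big_mkcond.
rewrite exchange_big; apply: eq_bigr => S _ /=.
rewrite -big_mkcondr sumr_const /F -[LHS]mulr_natr; congr (_ * _).
have sub : f @: S \subset G_set T.
  apply/subsetP => _ /imsetP[a _ ->]; apply/G_setP; left.
  exact/Irr_Lambda/(f_Irr f_img).
have -> : #|[pred phi : {ffun X -> T} | (phi \in ffun_on (G_set T)) && (S \subset missing phi)]| =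
    #|@ffun_on_mem X T (mem (G_set T :\: f @: S))|.
  apply: eq_card => phi; rewrite !inE; apply/andP/ffun_onP => [[/ffun_onP phiG /subsetP SM] x|H].
    rewrite inE phiG andbT; apply/imsetP => -[a /SM]; rewrite inE => /forallP/(_ x)/eqP; exact.
  split; first by apply/ffun_onP => x; have := H x; rewrite inE => /andP[].
  apply/subsetP => a aS; rewrite inE; apply/forallP => x; have := H x.
  by rewrite inE => /andP[nS _]; apply: contraNneq nS => ->; apply: imset_f.
rewrite card_ffun_on natrX cardsD (setIidPr sub) natrB ?subset_leq_card //.
by rewrite card_imset.
Qed.

Theorem theorem7p4 (k : fieldType) (k_char0 : [pchar k] =i pred0) (X : finType)
    (Rs : forall e : nat, {set {set 'I_e * 'I_e}})
    (Rs_reps : forall e : nat, order_representatives (Rs e))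
    (d : Order.disp_t)
    (T : forall e : nat, {set 'I_e * 'I_e} -> finTBLatticeType d)
    (T_irr : forall (e : nat) (R : {set 'I_e * 'I_e}),
       R \in Rs e -> irr_poset_is (T e R) R) :
  exists J : {vspace rel_alg k X},
    (forall a : rel_alg k X, a \in J <-> in_jacobson a) /\
    (\dim J)%:R =
      2%:R ^+ (#|X| ^ 2)
      - \sum_(e < #|X|.+1) \sum_(R in Rs e)
          (#|poset_aut R|%:R)^-1
          * (\sum_(i < e.+1) (-1) ^+ i * 'C(e, i)%:R
               * (#|G_set (T e R)|%:R - i%:R) ^+ #|X|) ^+ 2 :> rat.
Proof.
(* [Bas] and [d] must be total functions, so a basis is chosen for each representative and a dummy
   value elsewhere. *)
have basis_data e (R : {set 'I_e * 'I_e}) :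
    {Bd : {set {set X * 'I_e}} * ({set X * 'I_e} -> {set 'I_e * X} -> k) |
      R \in Rs e -> column_basis R Bd.1 Bd.2 /\
        #|Bd.1|%:R = \sum_(i < e.+1) (-1) ^+ i * 'C(e, i)%:R
               * (#|G_set (T e R)|%:R - i%:R) ^+ #|X| :> rat}.
  apply: constructive_indefinite_description.
  case: (boolP (R \in Rs e)) => [/T_irr[f [f_inj f_img f_R]]|_]; last first.
    by exists (set0, fun _ _ => 0).
  have [D HD] := lattice_column_basis k X f_inj f_img f_R.
  by exists (lattice_basis X f, D) => _; split; rewrite //= card_lattice_basis ?card_G_maps.
pose Bas e R := (sval (basis_data e R)).1; pose D e R := (sval (basis_data e R)).2.
have basis e R : R \in Rs e -> column_basis R (Bas e R) (D e R).
  by move=> RRs; have [] := svalP (basis_data e R) RRs.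
have [J [HJ dimJ]] := annihilator_dim Rs_reps basis.
exists J; split=> [a|].
  have radP := jacobson_annihilates_coefsP k_char0 a.
  by split=> [/HJ/radP | /radP/HJ].
apply/eqP; rewrite eq_sym subr_eq -natrX -dimJ natrD (card_coef_indices Rs_reps basis).
rewrite (inj_eq (addrI _)); apply/eqP; apply: eq_bigr => e _; apply: eq_bigr => R RRs.
by have [_ ->] := svalP (basis_data e R) RRs.
Qed.
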